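(* Let $\alpha\in(0,2)$, let $S_1,S_2\sim S_\alpha(1,0,0)$ be independent and let $a\in(0,1)$. Set $$X_1=aS_1+(1-a^\alpha)^{1/\alpha}S_2,\qquad X_2=-aS_1+(1-a^\alpha)^{1/\alpha}S_2,$$ and $X=(X_1,X_2)$ (so that $X_1,X_2\sim S_\alpha(1,0,0)$). Then the following are equivalent: (i) $a\le 2^{-1/\alpha}$; (ii) $X^0$ is a color process; (iii) $X^h$ is a color process for all $h\in\mathbb{R}$.
   Context: $S_\alpha(1,0,0)$ denotes the symmetric $\alpha$-stable distribution on $\mathbb{R}$ with characteristic function $\theta\mapsto e^{-|\theta|^\alpha}$. A $\{0,1\}$-valued process $(Y_i)_{i\in S}$ is a color process (divide and color process) if there are $p\in[0,1]$ and a random partition $\pi$ of $S$ such that $(Y_i)$ has the same law as the process obtained by sampling $\pi$ and then, independently of $\pi$ and independently for different partition elements, assigning all elements of a partition element the value $1$ with probability $p$ and the value $0$ with probability $1-p$. For a random vector $X=(X_i)$ and $h\in\mathbb{R}$, $X^h=(X^h_i)$ with $X^h_i=I(X_i>h)$. *)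

(* Defs.v *)
From HB Require Import structures.
From mathcomp Require Import all_boot all_order all_algebra.
From mathcomp Require Import all_classical all_reals all_analysis.
From mathcomp Require Import complex.

Set Implicit Arguments.
Unset Strict Implicit.
Unset Printing Implicit Defensive.

Import Order.TTheory GRing.Theory Num.Theory.
Import numFieldNormedType.Exports.

Local Open Scope classical_set_scope.
Local Open Scope ring_scope.

Section RandomVariables.
Context (d : measure_display) (T : measurableType d) (R : realType).
Variable P : probability T R.

(* E[exp(i theta X)] in R[i]; the real and imaginary parts are expectations
   of bounded measurable functions, hence finite. *)
Definition char_fun (X : {RV P >-> R}) (theta : R) : R[i] :=
  Complex (fine 'E_P[fun w => cos (theta * X w)])
          (fine 'E_P[fun w => sin (theta * X w)]).

(* X ~ S_alpha(1,0,0) *)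
Definition std_sym_stable (alpha : R) (X : {RV P >-> R}) : Prop :=
  forall theta : R,
    char_fun X theta = real_complex R (expR (- (`|theta| `^ alpha))).

Definition independent_RVs (X Y : {RV P >-> R}) : Prop :=
  forall A B : set R, measurable A -> measurable B ->
    (P (X @^-1` A `&` Y @^-1` B) = P (X @^-1` A) * P (Y @^-1` B))%E.

Definition threshold (I : Type) (X : I -> T -> R) (h : R) : I -> T -> bool :=
  fun i w => h < X i w.

End RandomVariables.

Section ColorProcess.
Variable R : realType.

Definition bern_weight (p : R) (b : bool) : R := if b then p else 1 - p.

(* Since S is finite, a random partition of S is given by its weights on the
   finite set of partitions of S. *)
Definition random_partition (S : finType) (q : {set {set S}} -> R) : Prop :=
  (forall pi, finset.partition pi (finset.setTfor S) -> 0 <= q pi) /\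
  \sum_(pi : {set {set S}} | finset.partition pi (finset.setTfor S)) q pi = 1.

(* Probability of the outcome y when pi is sampled from q and, independently,
   every B : {set S} gets an independent Bernoulli(p) colour c B; the process
   takes at i the colour of the block of pi containing i.  Colours of sets that
   are not blocks of pi are not used and sum out. *)
Definition color_law (S : finType) (p : R) (q : {set {set S}} -> R)
    (y : S -> bool) : R :=
  \sum_(pi : {set {set S}} | finset.partition pi (finset.setTfor S))
    \sum_(c : {ffun {set S} -> bool} | [forall i, c (finset.pblock pi i) == y i])
      q pi * \prod_(B : {set S}) bern_weight p (c B).

Definition color_process (S : finType) (d : measure_display)
    (T : measurableType d) (P : probability T R) (Y : S -> T -> bool) : Prop :=
  exists (p : R) (q : {set {set S}} -> R),
    [/\ 0 <= p <= 1, random_partition q &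
        forall y : S -> bool,
          P [set w | forall i, Y i w = y i] = (color_law p q y)%:E].

End ColorProcess.

(* Main.v *)
Require Import Defs.
From HB Require Import structures.
From mathcomp Require Import all_boot all_order all_algebra.
From mathcomp Require Import all_classical all_reals all_analysis.
From mathcomp Require Import measurable_realfun ring lra.
Import Order.TTheory GRing.Theory Num.Theory.
Import numFieldNormedType.Exports.
Local Open Scope classical_set_scope.
Local Open Scope ring_scope.

Set Implicit Arguments.
Unset Strict Implicit.
Unset Printing Implicit Defensive.

(* On two points, a process is a color process iff its marginals agree and its covariance
   is nonnegative, so everything is about the sign of Cov(1_{X1 > h}, 1_{X2 > h}).  Put
   A = a^alpha and B = 1 - A = b^alpha; condition (i) reads A <= B.

   If A <= B, then K(s, t) = E exp(i(s X1 - t X2)) - E exp(i s X1) E exp(- i t X2) equals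
   phi(s) phi(t) (exp(Q(s, t)) - 1), where phi(s) = exp(-|s|^alpha) and
   Q(s, t) = |s|^alpha + |t|^alpha - A |s + t|^alpha - B |s - t|^alpha is a limit of positive
   multiples of E((1 - cos sZ)(1 - cos tZ) + (B - A) sin sZ sin tZ) for small multiples Z of
   S1.  Hence Q is positive semidefinite, and so is K by Schur products and the exponential
   series.  Therefore Cov(g(X1), g(X2)) >= 0 for every trigonometric polynomial g, and the
   indicator of a half-line is obtained from such g by bounded pointwise limits.

   If A > B, then b < a.  Covariance >= 0 at h = 0 says that the cone b y > a |x| has
   probability at least 1/4 under the law of (S1, S2).  Its images under the symmetries of
   that law are four disjoint cones, so their complement is null; but it contains every
   product {q < |x| < qa/b} x {q < |y| < qa/b}, which forces S1 = 0 almost surely,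
   although the law of S1 has no atom at 0. *)

(** * Expectations of bounded measurable functions *)

Section BoundedExpectation.
Context d (T : measurableType d) (R : realType) (P : probability T R).
Implicit Types f g : T -> R.

Definition bounded_measurable f :=
  measurable_fun setT f /\ exists M, forall w, `|f w| <= M.

Lemma bmeas_integrable f :
  bounded_measurable f -> P.-integrable setT (EFin \o f).
Proof.
move=> [mf [M hM]]; apply: measurable_bounded_integrable => //.
  by rewrite (@le_lt_trans _ _ 1%E) ?ltry// probability_le1.
exists M; split; first exact: num_real.
by move=> x Mx w _; exact: le_trans (hM w) (ltW Mx).
Qed.

Lemma bmeas_cst r : bounded_measurable (fun=> r).
Proof. by split=> //; exists `|r|. Qed.

Lemma bmeasD f g : bounded_measurable f -> bounded_measurable g ->
  bounded_measurable (fun w => f w + g w).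
Proof.
move=> [mf [M hM]] [mg [N hN]]; split; first exact: measurable_funD.
by exists (M + N) => w; rewrite (le_trans (ler_normD _ _))// lerD.
Qed.

Lemma bmeasM f g : bounded_measurable f -> bounded_measurable g ->
  bounded_measurable (fun w => f w * g w).
Proof.
move=> [mf [M hM]] [mg [N hN]]; split; first exact: measurable_funM.
by exists (M * N) => w; rewrite normrM ler_pM.
Qed.

Lemma bmeasZ r f : bounded_measurable f -> bounded_measurable (fun w => r * f w).
Proof. by move=> bf; apply: bmeasM => //; exact: bmeas_cst. Qed.

Lemma bmeasB f g : bounded_measurable f -> bounded_measurable g ->
  bounded_measurable (fun w => f w - g w).
Proof.
move=> bf bg; have := bmeasD bf (bmeasZ (-1) bg).
by congr bounded_measurable; apply/funext => w; rewrite mulN1r.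
Qed.

Lemma bmeas_sum (I : Type) (l : seq I) (F : I -> T -> R) :
  (forall i, bounded_measurable (F i)) ->
  bounded_measurable (fun w => \sum_(i <- l) F i w).
Proof.
move=> bF; elim: l => [|i l IH].
  by under eq_fun do rewrite big_nil; exact: bmeas_cst.
by under eq_fun do rewrite big_cons; exact: bmeasD.
Qed.

Lemma bmeas_cos f : measurable_fun setT f ->
  bounded_measurable (fun w => cos (f w)).
Proof.
move=> mf; split; last by exists 1 => w; exact: cos_max.
apply: (@measurableT_comp _ _ _ _ _ _ (@cos R)) => //.
by apply: continuous_measurable_fun; exact: continuous_cos.
Qed.

Lemma bmeas_sin f : measurable_fun setT f ->
  bounded_measurable (fun w => sin (f w)).
Proof.
move=> mf; split; last by exists 1 => w; exact: sin_max.
apply: (@measurableT_comp _ _ _ _ _ _ (@sin R)) => //.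
by apply: continuous_measurable_fun; exact: continuous_sin.
Qed.

Lemma bmeas_indic (A : set T) : measurable A -> bounded_measurable (\1_A : T -> R).
Proof.
move=> mA; split; first exact: measurable_indic.
by exists 1 => w; rewrite indicE; case: (_ \in _); rewrite ?normr1 ?normr0.
Qed.

Local Notation E f := (\int[P]_w f w)%R.

Lemma expectD f g : bounded_measurable f -> bounded_measurable g ->
  \int[P]_w (f w + g w) = E f + E g.
Proof. by move=> bf bg; apply: RintegralD => //; exact: bmeas_integrable. Qed.

Lemma expectB f g : bounded_measurable f -> bounded_measurable g ->
  \int[P]_w (f w - g w) = E f - E g.
Proof. by move=> bf bg; apply: RintegralB => //; exact: bmeas_integrable. Qed.

Lemma expectZ r f : bounded_measurable f -> \int[P]_w (r * f w) = r * E f.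
Proof. by move=> bf; apply: RintegralZl => //; exact: bmeas_integrable. Qed.

Lemma expect_cst r : \int[P]_w r = r.
Proof.
rewrite Rintegral_cst//; have /= -> := @probability_setT _ _ _ P.
by rewrite /= mulr1.
Qed.

Lemma expect_sum (I : Type) (l : seq I) (F : I -> T -> R) :
  (forall i, bounded_measurable (F i)) ->
  \int[P]_w (\sum_(i <- l) F i w) = \sum_(i <- l) E (F i).
Proof.
move=> bF; elim: l => [|i l IH].
  by under eq_Rintegral do rewrite big_nil; rewrite big_nil expect_cst.
under eq_Rintegral do rewrite big_cons.
by rewrite expectD// ?IH ?big_cons//; exact: bmeas_sum.
Qed.

Lemma expect_ge0 f : (forall w, 0 <= f w) -> 0 <= E f.
Proof. by move=> f0; exact: Rintegral_ge0. Qed.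

Lemma expect_le f g : bounded_measurable f -> bounded_measurable g ->
  (forall w, f w <= g w) -> E f <= E g.
Proof. by move=> bf bg fg; apply: le_Rintegral => //; exact: bmeas_integrable. Qed.

Lemma expect_indic (A : set T) : measurable A -> \int[P]_w \1_A w = fine (P A).
Proof. by move=> mA; rewrite /Rintegral integral_indic// setIT. Qed.

Lemma bounded_convergence (f_ : nat -> T -> R) f M :
  (forall n, measurable_fun setT (f_ n)) -> (forall n w, `|f_ n w| <= M) ->
  (forall w, f_ n w @[n --> \oo] --> f w) ->
  \int[P]_w f_ n w @[n --> \oo] --> E f.
Proof.
move=> mf bf cf.
have bM (w : T) : `|f w| <= M.
  have h : `|f_ n w| @[n --> \oo] --> `|f w| by apply: cvg_norm; exact: cf.
  rewrite -(cvg_lim _ h)//; apply: limr_le; first by apply/cvg_ex; exists `|f w|.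
  exact: nearW.
have mfl : measurable_fun setT f by exact: measurable_fun_cvg mf (fun w _ => cf w).
apply: fine_cvg; rewrite fineK; last first.
  by apply: integrable_fin_num => //; apply: bmeas_integrable; split => //; exists M.
apply: (@dominated_cvg _ _ _ _ _ _ _ _ (cst M%:E)) => //.
- by move=> n; exact/measurable_EFinP.
- by move=> w _; apply: cvg_EFin; [exact: nearW | exact: cf].
- exact: (bmeas_integrable (bmeas_cst M)).
- by move=> n w _ /=; rewrite lee_fin.
Qed.

End BoundedExpectation.

(** * Trigonometric polynomials *)

Section RealSequences.
Variable R : realType.

Lemma bernoulli_ineq (x : R) n : -1 <= x -> 1 + n%:R * x <= (1 + x) ^+ n.
Proof.
move=> x1; elim: n => [|n IH]; first by rewrite mul0r addr0 expr0.
rewrite exprS; apply: (@le_trans _ _ ((1 + x) * (1 + n%:R * x))).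
  rewrite -natr1; have : 0 <= n%:R * x ^+ 2 by rewrite mulr_ge0 ?sqr_ge0.
  by rewrite expr2; lra.
by rewrite ler_wpM2l//; lra.
Qed.

(** With [w] the square root of [z], Bernoulli's inequality at [w^-1] bounds [n * w ^+ n] by
    [(1 - w)^-1]; the remaining factor [w ^+ n] is geometric. *)
Lemma cvg_natM_exp0 (z : R) : 0 <= z < 1 -> n%:R * z ^+ n @[n --> \oo] --> 0.
Proof.
move=> /andP[z0 z1]; set w := Num.sqrt z.
have w0 : 0 <= w by exact: sqrtr_ge0.
have zw : z = w ^+ 2 by rewrite sqr_sqrtr.
have w1 : w < 1 by rewrite -sqrtr1 ltr_sqrt.
have bnd n : (n%:R * w ^+ n) * (1 - w) <= 1.
  have [->|wn0] := eqVneq w 0.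
    case: n => [|n]; first by rewrite mul0r mul0r.
    by rewrite expr0n /= mulr0 mul0r.
  have wp : 0 < w by rewrite lt_neqAle eq_sym wn0.
  have /(_ n) B := @bernoulli_ineq (w^-1 - 1).
  have wV : 0 < w^-1 by rewrite invr_gt0.
  have {}B : n%:R * (w^-1 - 1) <= w ^- n.
    have h := B ltac:(lra); rewrite -exprVn.
    by apply: (le_trans _ (le_trans h _)); [lra|rewrite addrC subrK].
  apply: (@le_trans _ _ (n%:R * w ^+ n * (w^-1 - 1))).
    apply: ler_wpM2l; first by rewrite mulr_ge0 ?exprn_ge0.
    have -> : w^-1 - 1 = w^-1 * (1 - w) by field.
    apply: ler_peMl; first lra.
    by rewrite invf_ge1// ltW.
  have wn : 0 < w ^+ n by rewrite exprn_gt0.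
  rewrite mulrAC; apply: (le_trans (ler_wpM2r (ltW wn) B)).
  by rewrite mulVf// gt_eqF.
apply: (@squeeze_cvgr _ _ _ _ (fun=> 0) (geometric (1 - w)^-1 w)).
- near=> n; rewrite mulr_ge0 ?exprn_ge0//= zw -exprM mulnC exprM expr2 mulrA.
  rewrite ler_wpM2r ?exprn_ge0// -(ler_pM2r (x:=1 - w)); last by lra.
  rewrite mulVf; first exact: bnd.
  by rewrite subr_eq0 gt_eqF.
- exact: cvg_cst.
- by apply: cvg_geometric; rewrite ger0_norm.
Unshelve. all: by end_near. Qed.

(** Chosen so that [step_exp n * v ^+ n] equals [n * (2 * v) ^+ n], which tends to 0 for
    [0 <= v < 1/2] and is at least [n] for [v >= 1/2]. *)
Definition step_exp n : nat := (n * 2 ^ n)%N.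

(** Below [1/2], Bernoulli's inequality bounds the power from below by [1 - n * (2 * v) ^+ n]; from
    [1/2] on, [1 - x <= expR (- x)] bounds it from above by [expR (- n)]. *)
Lemma cvg_step (v : R) : 0 <= v <= 1 ->
  (1 - v ^+ n) ^+ step_exp n @[n --> \oo] --> ((v < 2^-1)%R%:R : R).
Proof.
move=> /andP[v0 v1].
have vn n : 0 <= v ^+ n <= 1 by rewrite exprn_ge0// exprn_ile1.
have [vlt|vge] := ltP v 2^-1.
  apply: (@squeeze_cvgr _ _ _ _ (fun n => 1 - n%:R * (2 * v) ^+ n) (fun=> 1)).
  - near=> n; have /andP[h0 h1] := vn n; apply/andP; split.
      have := @bernoulli_ineq (- v ^+ n) (step_exp n) ltac:(lra).
      by rewrite mulrN /step_exp natrM natrX exprMn mulrA.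
    by rewrite exprn_ile1//; lra.
  - rewrite -[X in _ --> X]subr0; apply: cvgB; first exact: cvg_cst.
    by apply: cvg_natM_exp0; lra.
  - exact: cvg_cst.
apply: (@squeeze_cvgr _ _ _ _ (fun=> 0) (fun n => expR (- n%:R))).
- near=> n; have /andP[h0 h1] := vn n; apply/andP; split.
    by rewrite exprn_ge0//; lra.
  have e : - n%:R = (step_exp n)%:R * - 2^-1 ^+ n :> R.
    rewrite /step_exp natrM natrX mulrN -mulrA -exprMn mulfV; last by lra.
    by rewrite expr1n mulr1.
  rewrite e expRM_natl; apply: lerXn2r; rewrite ?nnegrE ?expR_ge0//; first lra.
  have := expR_ge1Dx (- 2^-1 ^+ n : R).
  have : 2^-1 ^+ n <= v ^+ n :> R by apply: lerXn2r; rewrite ?nnegrE//; lra.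
  lra.
- exact: cvg_cst.
- exact: cvgn_expR.
Unshelve. all: by end_near. Qed.

End RealSequences.

Section TrigPolynomials.
Variable R : realType.
Implicit Types (g : R -> R) (l : seq (R * R * R)).

(* The triple ((c, s), r) encodes the function x |-> c * cos (s * x + r). *)
Definition trig_sum l (x : R) : R := \sum_(u <- l) u.1.1 * cos (u.1.2 * x + u.2).

Definition trig_poly g := exists l, g = trig_sum l.

Lemma trig_cos c s r : trig_poly (fun x => c * cos (s * x + r)).
Proof.
by exists [:: (c, s, r)]; apply/funext => x; rewrite /trig_sum big_seq1.
Qed.

Lemma trig_cst c : trig_poly (fun=> c).
Proof.
have := trig_cos c 0 0; congr trig_poly; apply/funext => x.
by rewrite mul0r addr0 cos0 mulr1.
Qed.

Lemma trigD f g : trig_poly f -> trig_poly g -> trig_poly (fun x => f x + g x).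
Proof.
move=> [l ->] [k ->]; exists (l ++ k); apply/funext => x.
by rewrite /trig_sum big_cat.
Qed.

Lemma cosMcos (x y : R) : cos x * cos y = 2^-1 * (cos (x + y) + cos (x - y)).
Proof. by rewrite cosD cosB; field. Qed.

(** The product-to-sum formula turns a product of two phase-shifted cosines into two such cosines,
    so sines never need a separate encoding. *)
Lemma trig_sumM l k : trig_poly (fun x => trig_sum l x * trig_sum k x).
Proof.
elim: l => [|u l [m IH]].
  have := trig_cst 0; congr trig_poly; apply/funext => x.
  by rewrite /trig_sum big_nil mul0r.
have [m' h] : trig_poly (fun x => u.1.1 * cos (u.1.2 * x + u.2) * trig_sum k x).
  elim: k {IH} => [|v k IH].
    have := trig_cst 0; congr trig_poly; apply/funext => x.
    by rewrite /trig_sum big_nil mulr0.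
  have := trigD (trigD
    (trig_cos (2^-1 * u.1.1 * v.1.1) (u.1.2 + v.1.2) (u.2 + v.2))
    (trig_cos (2^-1 * u.1.1 * v.1.1) (u.1.2 - v.1.2) (u.2 - v.2))) IH.
  congr trig_poly; apply/funext => x; rewrite [in RHS]/trig_sum big_cons.
  rewrite mulrDr; congr (_ + _); rewrite -mulrDr.
  rewrite mulrACA cosMcos mulrA; congr (_ * (cos _ + cos _)); ring.
exists (m' ++ m); apply/funext => x; rewrite /trig_sum big_cat/=.
have /(congr1 (@^~ x)) := h; have /(congr1 (@^~ x)) := IH.
by rewrite /trig_sum => <- <-; rewrite big_cons mulrDl.
Qed.

Lemma trigM f g : trig_poly f -> trig_poly g -> trig_poly (fun x => f x * g x).
Proof. by move=> [l ->] [k ->]; exact: trig_sumM. Qed.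

Lemma trigX f n : trig_poly f -> trig_poly (fun x => f x ^+ n).
Proof.
move=> tf; elim: n => [|n IH]; first exact: trig_cst.
by have := trigM tf IH; congr trig_poly; apply/funext => x; rewrite exprS.
Qed.

Lemma trig1B f : trig_poly f -> trig_poly (fun x => 1 - f x).
Proof.
move=> /(trigM (trig_cst (-1))) /(trigD (trig_cst 1)).
by congr trig_poly; apply/funext => x; rewrite mulN1r.
Qed.

Lemma measurable_trig f : trig_poly f -> measurable_fun setT f.
Proof.
move=> [l ->]; apply: measurable_sum => u; apply: measurable_funM => //.
have [] // := @bmeas_cos _ _ _ (fun x : R => u.1.2 * x + u.2).
by apply: measurable_funD => //; apply: measurable_funM.
Qed.

(* [sin (pi * (x - h) / M)] has the sign of [x - h] as soon as [`|x - h| < M], and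
   its positivity is the pointwise limit of powers [(1 - v ^+ n) ^+ (n * 2 ^ n)]
   where [v = (1 - sin _) / 2]. *)
Lemma trig_closure_ray (C : (R -> R) -> Prop) :
  (forall g, trig_poly g -> C g) ->
  (forall (f_ : nat -> R -> R) f, (forall n, measurable_fun setT (f_ n)) ->
    (forall n x, `|f_ n x| <= 1) -> (forall x, f_ n x @[n --> \oo] --> f x) ->
    (forall n, C (f_ n)) -> C f) ->
  forall h, C (fun x => (h < x)%R%:R).
Proof.
move=> Ctrig Clim h.
pose v (k : nat) (x : R) := (1 - sin (pi * (x - h) / k.+1%:R)) / 2.
have v01 k x : 0 <= v k x <= 1.
  rewrite /v; move: (pi * _ / _) => y.
  by have := sin_geN1 y; have := sin_le1 y; lra.
pose q k n x := (1 - v k x ^+ n) ^+ step_exp n.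
have tq k n : trig_poly (q k n).
  apply: trigX; apply: trig1B; apply: trigX.
  (* The sine is a cosine whose phase is lowered by [pi / 2]. *)
  have := trigM (trig_cst 2^-1) (trig1B (trig_cos 1 (pi / k.+1%:R)
    (- (pi * h / k.+1%:R) - pi / 2))).
  congr trig_poly; apply/funext => x; rewrite /v mul1r addrA cosBpihalf mulrC.
  congr ((1 - sin _) / _); rewrite mulrBr mulrBl; congr (_ - _).
  by rewrite mulrAC.
have bq k n x : `|q k n x| <= 1.
  have /andP[v0 v1] := v01 k x.
  have vn : 0 <= v k x ^+ n <= 1 by rewrite exprn_ge0// exprn_ile1.
  rewrite ger0_norm /q; first by rewrite exprn_ile1//; lra.
  by rewrite exprn_ge0//; lra.
have mq k n : measurable_fun setT (q k n) by exact: measurable_trig.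
pose f k x : R := (v k x < 2^-1)%R%:R.
have qf k x : q k n x @[n --> \oo] --> f k x by exact: cvg_step.
have Cf k : C (f k).
  apply: Clim (mq k) (bq k) (qf k) _ => n; exact/Ctrig/tq.
apply: Clim Cf => [k|k x|x].
- exact: measurable_fun_cvg (mq k) (fun x _ => qf k x).
- by rewrite /f; case: (_ < _); rewrite ?normr1 ?normr0.
(* The limit in [n] was taken at a fixed period. Now the period grows: once [k.+1] exceeds the
   distance from [x] to [h], [f k x] is the value of the indicator. *)
apply: cvg_near_cst; near=> k; congr ((nat_of_bool _)%:R).
have kx : `|x - h| < k.+1%:R.
  near: k; exists (Num.truncn `|x - h|) => // k /= hk.
  by rewrite (lt_le_trans (Num.Theory.truncnS_gt _))// ler_nat.
have k0 : 0 < k.+1%:R :> R by rewrite ltr0n.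
have vE : (v k x < 2^-1) = (0 < sin (pi * (x - h) / k.+1%:R)).
  by rewrite /v; apply/idP/idP; lra.
rewrite vE; have pi0 := pi_gt0 R.
have [hx|xh] := ltP h x.
  apply: sin_gt0_pi; rewrite divr_gt0 ?mulr_gt0 ?subr_gt0//=.
  rewrite ltr_pdivrMr// ltr_pM2l//.
  by apply: le_lt_trans kx; exact: ler_norm.
apply/negbTE; rewrite -leNgt -oppr_ge0 -sinN -mulNr -mulrN opprB.
apply: sin_ge0_pi; rewrite divr_ge0 ?mulr_ge0 ?subr_ge0 ?pi_ge0//=.
rewrite ler_pdivrMr// ler_pM2l//.
by apply: le_trans (ltW kx); rewrite distrC; exact: ler_norm.
Unshelve. all: by end_near. Qed.

End TrigPolynomials.

(** * Positive semidefinite kernels *)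

Section PositiveSemidefiniteKernels.
Variable R : realType.

(** Weighted points form a list with repetitions allowed, so rescaling weights or adjoining
    reflected points is a mere operation on the list. *)
Definition psd (X : Type) (K : X -> X -> R) :=
  forall l : seq (R * X), 0 <= \sum_(u <- l) \sum_(v <- l) u.1 * v.1 * K u.2 v.2.

Section General.
Variable X : Type.
Implicit Types K M : X -> X -> R.

Lemma eq_psd K M : (forall x y, K x y = M x y) -> psd K -> psd M.
Proof.
move=> KM pK l; have := pK l; congr (0 <= _).
by apply: eq_bigr => u _; apply: eq_bigr => v _; rewrite KM.
Qed.

Lemma psdD K M : psd K -> psd M -> psd (fun x y => K x y + M x y).
Proof.
move=> pK pM l; rewrite (_ : \sum_(u <- l) _ =
    \sum_(u <- l) \sum_(v <- l) u.1 * v.1 * K u.2 v.2 +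
    \sum_(u <- l) \sum_(v <- l) u.1 * v.1 * M u.2 v.2).
  exact: addr_ge0 (pK l) (pM l).
rewrite -big_split; apply: eq_bigr => u _; rewrite -big_split.
by apply: eq_bigr => v _; rewrite mulrDr.
Qed.

Lemma psd_scale (f : X -> R) K : psd K -> psd (fun x y => f x * f y * K x y).
Proof.
move=> pK l; have := pK [seq (u.1 * f u.2, u.2) | u <- l]; congr (0 <= _).
rewrite big_map; apply: eq_bigr => u _; rewrite big_map.
by apply: eq_bigr => v _ /=; rewrite [in RHS]mulrA -(mulrACA u.1).
Qed.

Lemma psdZ r K : 0 <= r -> psd K -> psd (fun x y => r * K x y).
Proof.
move=> r0 /(psd_scale (fun=> Num.sqrt r)); apply: eq_psd => x y.
by rewrite -expr2 sqr_sqrtr.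
Qed.

Lemma psd1 : psd (fun _ _ : X => 1).
Proof.
move=> l; under eq_bigr do under eq_bigr do rewrite mulr1.
by under eq_bigr do rewrite -mulr_sumr; rewrite -mulr_suml -expr2 sqr_ge0.
Qed.

Lemma psd_cvg (K_ : nat -> X -> X -> R) K :
  (forall n, psd (K_ n)) -> (forall x y, K_ n x y @[n --> \oo] --> K x y) -> psd K.
Proof.
move=> pK cK l; pose q (M : X -> X -> R) :=
  \sum_(u <- l) \sum_(v <- l) u.1 * v.1 * M u.2 v.2.
have cq : q (K_ n) @[n --> \oo] --> q K.
  apply: cvg_big => [|u _]; first exact: add_continuous.
  apply: cvg_big => [|v _]; first exact: add_continuous.
  by apply: cvgM; [exact: cvg_cst|exact: cK].
rewrite -/(q K) -(cvg_lim _ cq)//.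
apply: limr_ge; first by apply/cvg_ex; exists (q K).
by apply: nearW => n; exact: pK.
Qed.

(** The Schur product theorem for a Gram kernel E(U_x U_y): at each fixed [w] the factors [U x w]
    are absorbed into the weights, and the nonnegative quadratic forms are then integrated. *)
Lemma psdM_expect d (T : measurableType d) (P : probability T R)
    (U : X -> T -> R) M :
  (forall x, bounded_measurable (U x)) -> psd M ->
  psd (fun x y => M x y * \int[P]_w (U x w * U y w)).
Proof.
move=> bU pM l.
have bUU x y r : bounded_measurable (fun w => r * (U x w * U y w)).
  exact/bmeasZ/bmeasM.
rewrite (_ : \sum_(u <- l) _ = \int[P]_w (\sum_(u <- l) \sum_(v <- l)
    (u.1 * v.1 * M u.2 v.2 * (U u.2 w * U v.2 w)))); last first.
  rewrite expect_sum; last by move=> u; exact: bmeas_sum.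
  apply: eq_bigr => u _; rewrite expect_sum//.
  by apply: eq_bigr => v _; rewrite expectZ ?mulrA//; exact: bmeasM.
apply: expect_ge0 => w; have := psd_scale (U ^~ w) pM l; congr (0 <= _).
by apply: eq_bigr => u _; apply: eq_bigr => v _; ring.
Qed.

(** Repeated multiplication by [Q] makes all its powers positive semidefinite, and [expR Q - 1] is a
    limit of combinations of these powers with coefficients [1 / k!]. *)
Lemma psd_expm1 (Q : X -> X -> R) :
  (forall M, psd M -> psd (fun x y => M x y * Q x y)) ->
  psd (fun x y => expR (Q x y) - 1).
Proof.
move=> schurQ.
have pX k : psd (fun x y => Q x y ^+ k).
  elim: k => [|k /schurQ]; first exact: psd1.
  by apply: eq_psd => x y; rewrite exprSr.
(* Taking [n.+1] terms ensures that the constant term is present and cancels the [- 1]. *)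
apply: (@psd_cvg (fun n x y => series (exp_coeff (Q x y)) n.+1 - 1)) => [n|x y].
  have p0 : psd (fun _ _ : X => 0 : R).
    by apply: eq_psd (psdZ (lexx 0) psd1) => x y; rewrite mul0r.
  apply: (@eq_psd (fun x y => \sum_(0 <= k < n) Q x y ^+ k.+1 / k.+1`!%:R)).
    move=> x y; rewrite /series/= big_nat_recl//=.
    rewrite /exp_coeff /= fact0 expr0 divr1.
    by rewrite addrAC subrr add0r.
  elim: n => [|n IH].
    by apply: eq_psd p0 => x y; rewrite big_nil.
  apply: (@eq_psd (fun x y => \sum_(0 <= k < n) Q x y ^+ k.+1 / k.+1`!%:R +
      (n.+1`!%:R)^-1 * Q x y ^+ n.+1)) => [x y|].
    by rewrite big_nat_recr//= [X in _ + X]mulrC.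
  by apply: psdD => //; apply: psdZ => //; rewrite invr_ge0.
apply: cvgB; last exact: cvg_cst.
have := is_cvg_series_exp_coeff (Q x y); rewrite -/(expR _) -cvg_shiftS; exact.
Qed.

End General.

(** Testing [K] on the points together with their reflections, the latter weighted by [e], gives
    twice the new quadratic form. The values [e = 1] and [e = -1] serve the cosine and sine parts of
    a phase. *)
Lemma psd_reflect (K : R -> R -> R) (e : R) : e ^+ 2 = 1 ->
  (forall s t, K (- s) (- t) = K s t) -> psd K ->
  psd (fun s t => K s t + e * K s (- t)).
Proof.
move=> e2 KN pK l.
have := pK (l ++ [seq (e * u.1, - u.2) | u <- l]).
move=> h; rewrite -(pmulr_rge0 _ (ltr0n R 2)); apply: le_trans h _.
rewrite le_eqVlt big_cat big_map /= -big_split mulr_sumr; apply/orP; left; apply/eqP.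
apply: eq_bigr => u _; rewrite mulr_sumr !big_cat !big_map /= -!big_split /=.
apply: eq_bigr => v _.
have -> : K (- u.2) v.2 = K u.2 (- v.2) by rewrite -[in LHS](opprK v.2) KN.
rewrite KN; have -> : e * u.1 * (e * v.1) = u.1 * v.1.
  by rewrite mulrACA -expr2 e2 mul1r.
by ring.
Qed.

End PositiveSemidefiniteKernels.

(** * The covariance kernel of the stable pair *)

Section StableKernel.
Variable R : realType.

(** The squeeze is [y / (1 + y) <= 1 - expR (- y) <= y] at [y = x / n.+1]. *)
Lemma cvg_expm1 (x : R) : 0 <= x ->
  n.+1%:R * (1 - expR (- (x / n.+1%:R))) @[n --> \oo] --> x.
Proof.
move=> x0.
apply: (@squeeze_cvgr _ _ _ _ (fun n => x / (1 + x / n.+1%:R)) (fun=> x)).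
- near=> n; have n0 : 0 < n.+1%:R :> R by rewrite ltr0n.
  set y := x / n.+1%:R; have y0 : 0 <= y by rewrite divr_ge0// ltW.
  have xE : x = n.+1%:R * y by rewrite /y mulrC divfK// gt_eqF.
  rewrite {1 2}xE -mulrA; apply/andP; split; rewrite ler_pM2l//; last first.
    by have := expR_ge1Dx (- y); lra.
  have y1 : 0 < 1 + y by lra.
  have : expR (- y) <= (1 + y)^-1.
    by rewrite expRN lef_pV2 ?posrE ?expR_gt0//; exact: expR_ge1Dx.
  have -> : y / (1 + y) = 1 - (1 + y)^-1 by field; rewrite gt_eqF.
  lra.
- rewrite -[X in _ --> X]divr1; apply: cvgM; first exact: cvg_cst.
  apply: cvgV => //; rewrite -[X in _ --> X]addr0; apply: cvgD; first exact: cvg_cst.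
  by rewrite -[X in _ --> X](mulr0 x); apply: cvgM; [exact: cvg_cst|exact: cvg_harmonic].
- exact: cvg_cst.
Unshelve. all: by end_near. Qed.

Variables (d : measure_display) (T : measurableType d) (P : probability T R).
Variables (alpha A B : R) (S : T -> R).
Hypotheses (alpha_gt0 : 0 < alpha) (AB : A <= B) (AB1 : A + B = 1).
Hypothesis mS : measurable_fun setT S.
Hypothesis cosS : forall theta,
  \int[P]_w cos (theta * S w) = expR (- (`|theta| `^ alpha)).

(** The logarithm of the ratio of E cos(s X1 - t X2) to phi(s) phi(t), written Q in the overview. *)
Definition stable_exponent (s t : R) : R :=
  `|s| `^ alpha + `|t| `^ alpha - A * `|s + t| `^ alpha - B * `|s - t| `^ alpha.

(* [stable_exponent s t] is the limit of
   [n * E((1 - cos (s Z)) (1 - cos (t Z)) + (B - A) sin (s Z) sin (t Z))]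
   for [Z = n^(-1/alpha) S]. *)
Lemma psdM_stable_exponent (M : R -> R -> R) :
  psd M -> psd (fun s t => M s t * stable_exponent s t).
Proof.
(* This scale satisfies [z n ^ alpha = 1 / n.+1], so [z n * S] has characteristic function [e n]. *)
move=> pM; pose z n := n.+1%:R `^ (- alpha^-1) : R.
pose U n s w : R := 1 - cos (s * (z n * S w)).
pose V n s w := sin (s * (z n * S w)).
have mz n s : measurable_fun setT (fun w => s * (z n * S w)).
  by do 2 (apply: measurable_funM => //).
have bU n s : bounded_measurable (U n s).
  by apply: bmeasB; [exact: bmeas_cst|exact: bmeas_cos].
have bV n s : bounded_measurable (V n s) by exact: bmeas_sin.
pose e n (s : R) := expR (- (`|s| `^ alpha / n.+1%:R)).
have cosZ n s : \int[P]_w cos (s * (z n * S w)) = e n s.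
  under eq_Rintegral do rewrite mulrA.
  rewrite cosS normrM powRM// (ger0_norm (powR_ge0 _ _)) -powRrM mulNr mulVf ?gt_eqF//.
  by rewrite powR_inv1.
apply: (@psd_cvg _ _ (fun n s t => n.+1%:R *
    (M s t * \int[P]_w (U n s w * U n t w) +
     (B - A) * (M s t * \int[P]_w (V n s w * V n t w))))) => [n|s t].
  apply: psdZ => //; apply: psdD; first exact: psdM_expect.
  (* Here the hypothesis [A <= B] enters, as the sign of the sine term. *)
  by apply: psdZ; [rewrite subr_ge0|exact: psdM_expect].
have bc n r : bounded_measurable (fun w => cos (r * (z n * S w))).
  exact: bmeas_cos.
have EU n : \int[P]_w (U n s w * U n t w) =
    1 - e n s - e n t + 2^-1 * (e n (s + t) + e n (s - t)).
  rewrite -!cosZ -expectD// -expectZ; last exact: bmeasD.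
  rewrite -[X in X - _ - _](expect_cst P) -!expectB//; first last.
  - exact: bmeas_cst.
  - by apply: bmeasB => //; exact: bmeas_cst.
  rewrite -expectD; first last.
  - by apply: bmeasZ; exact: bmeasD.
  - by apply: bmeasB => //; apply: bmeasB => //; exact: bmeas_cst.
  apply: eq_Rintegral => w _.
  by rewrite /U (mulrDl s t) (mulrBl (z n * S w) s t) -cosMcos; ring.
have EV n : \int[P]_w (V n s w * V n t w) =
    2^-1 * (e n (s - t) - e n (s + t)).
  rewrite -!cosZ -expectB// -expectZ; last exact: bmeasB.
  apply: eq_Rintegral => w _.
  by rewrite /V (mulrDl s t) (mulrBl (z n * S w) s t) cosB cosD; field.
pose x (r : R) n : R := n.+1%:R * (1 - e n r).
have cx r : x r n @[n --> \oo] --> `|r| `^ alpha by apply: cvg_expm1; exact: powR_ge0.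
(* As [A + B = 1], the coefficients of [e n (s + t)] and [e n (s - t)] are [(1 - (B - A)) / 2 = A]
   and [(1 + (B - A)) / 2 = B], and the constants regroup into the differences [1 - e n r]. *)
rewrite (_ : (fun n => _) = fun n =>
    M s t * (x s n + x t n - A * x (s + t) n - B * x (s - t) n)); last first.
  apply/funext => n; rewrite EU EV /x.
  have -> : B = 1 - A by rewrite -AB1 addrAC subrr add0r.
  move: (e n s) (e n t) (e n (s + t)) (e n (s - t)) n.+1%:R (M s t) => *; by field.
apply: cvgM; first exact: cvg_cst.
apply: cvgB; last by apply: cvgM; [exact: cvg_cst|exact: cx].
apply: cvgB; last by apply: cvgM; [exact: cvg_cst|exact: cx].
by apply: cvgD; exact: cx.
Qed.

(** The kernel K of the overview in closed form; it is real by symmetry of the stable laws. *)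
Definition stable_cov_kernel (s t : R) : R :=
  expR (- (A * `|s + t| `^ alpha + B * `|s - t| `^ alpha)) -
  expR (- (`|s| `^ alpha)) * expR (- (`|t| `^ alpha)).

Lemma psd_stable_cov_kernel : psd stable_cov_kernel.
Proof.
have := psd_scale (fun s => expR (- (`|s| `^ alpha)))
  (psd_expm1 psdM_stable_exponent).
apply: eq_psd => s t; rewrite mulrBr mulr1 /stable_cov_kernel -!expRD.
by congr (expR _ - _); rewrite /stable_exponent; ring.
Qed.

Lemma stable_cov_kernelN s t :
  stable_cov_kernel (- s) (- t) = stable_cov_kernel s t.
Proof.
have eB : `|- s - - t| = `|s - t| by rewrite -opprD normrN.
have eD : `|- s + - t| = `|s + t| by rewrite -opprD normrN.
by rewrite /stable_cov_kernel eB eD (normrN s) (normrN t).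
Qed.

End StableKernel.

(** * Joint laws and characteristic functions *)

Section JointLaw.
Context d (T : measurableType d) (R : realType) (P : probability T R).
Implicit Types X Y : {RV P >-> R}.

Definition pair_RV X Y (w : T) : (R * R)%type := (X w, Y w).

Lemma measurable_pair_RV X Y : measurable_fun setT (pair_RV X Y).
Proof. exact/measurable_fun_pair. Qed.

HB.instance Definition _ X Y :=
  isMeasurableFun.Build _ _ _ _ (pair_RV X Y) (measurable_pair_RV X Y).

(** Independence gives equality on rectangles, which determine the product measure. *)
Lemma joint_lawE X Y (A : set (R * R)) : independent_RVs X Y -> measurable A ->
  P (pair_RV X Y @^-1` A) = (distribution P X \x distribution P Y)%E A.
Proof.
move=> XY mA; apply/esym.
by apply: (@product_measure_unique _ _ _ _ _ (distribution P X)
  (distribution P Y) (distribution P (pair_RV X Y))) => // B C mB mC; exact: XY.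
Qed.

(** Transfer to the product of the two laws, then Fubini. *)
Lemma expect_indep X Y (f g : R -> R) : independent_RVs X Y ->
  bounded_measurable f -> bounded_measurable g ->
  \int[P]_w (f (X w) * g (Y w)) = (\int[P]_w f (X w)) * (\int[P]_w g (Y w)).
Proof.
move=> XY bf bg.
pose F (z : R * R) := f z.1 * g z.2.
have bF : bounded_measurable F.
  apply: bmeasM.
    have [mf [M hM]] := bf; split; last by exists M => z.
    exact: measurableT_comp mf measurable_fst.
  have [mg [M hM]] := bg; split; last by exists M => z.
  exact: measurableT_comp mg measurable_snd.
have bfX : bounded_measurable (f \o X).
  by have [mf [M hM]] := bf; split; [exact: measurableT_comp|exists M => z; exact: hM].
have bgY : bounded_measurable (g \o Y).
  by have [mg [M hM]] := bg; split; [exact: measurableT_comp|exists M => z; exact: hM].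
have bFXY : bounded_measurable (F \o pair_RV X Y) by exact: bmeasM.
have fX : (\int[distribution P X]_x (f x)%:E = (\int[P]_w f (X w))%:E)%E.
  rewrite integral_distribution//.
  - by rewrite fineK//; apply: integrable_fin_num => //; exact: bmeas_integrable.
  - by apply/measurable_EFinP; have [] := bf.
  - exact: bmeas_integrable.
have gY : (\int[distribution P Y]_x (g x)%:E = (\int[P]_w g (Y w))%:E)%E.
  rewrite integral_distribution//.
  - by rewrite fineK//; apply: integrable_fin_num => //; exact: bmeas_integrable.
  - by apply/measurable_EFinP; have [] := bg.
  - exact: bmeas_integrable.
have h : (\int[P]_w (F (pair_RV X Y w))%:E =
    \int[distribution P X \x distribution P Y]_z (F z)%:E)%E.
  rewrite -(@integral_distribution _ _ _ _ _ P (pair_RV X Y) (EFin \o F)); first last.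
  - exact: bmeas_integrable.
  - by apply/measurable_EFinP; have [] := bF.
  by apply: eq_measure_integral => A mA _; exact: joint_lawE.
rewrite /Rintegral -[X in fine X]/(\int[P]_w (F (pair_RV X Y w))%:E)%E h.
rewrite -integral12_prod_meas1.
  rewrite (eq_integral (fun x => ((f x)%:E * (\int[P]_w g (Y w))%:E)%E)); last first.
    move=> x _; rewrite /fubini_F -gY -integralZl//; last exact: bmeas_integrable.
  rewrite integralZr//; last exact: bmeas_integrable.
  by rewrite fX.
apply/integrableP; split; first by apply/measurable_EFinP; have [] := bF.
have [_ [M hM]] := bF.
apply: (@le_lt_trans _ _ (\int[distribution P X \x distribution P Y]_z M%:E)%E).
  apply: ge0_le_integral => //.
  - by apply: measurableT_comp => //; apply/measurable_EFinP; have [] := bF.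
  - by move=> z _ /=; rewrite lee_fin.
rewrite integral_cst//; set m := (X in (_ * X < _)%E).
(* The mass of the product measure is read off from the joint law of the whole plane. *)
have -> : m = 1%E by rewrite -(@probability_setT _ _ _ P); exact/esym/joint_lawE.
by rewrite mule1 ltry.
Qed.

Lemma eq_joint_law X Y X' Y' (A : set (R * R)) :
  independent_RVs X Y -> independent_RVs X' Y' ->
  (forall B, measurable B -> P (X @^-1` B) = P (X' @^-1` B)) ->
  (forall B, measurable B -> P (Y @^-1` B) = P (Y' @^-1` B)) ->
  measurable A ->
  P (pair_RV X Y @^-1` A) = P (pair_RV X' Y' @^-1` A).
Proof.
move=> XY XY' eX eY mA; rewrite joint_lawE//.
apply: (@product_measure_unique _ _ _ _ _ (distribution P X)
  (distribution P Y) (distribution P (pair_RV X' Y'))) => // B C mB mC /=.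
by rewrite /distribution/= /pushforward/= eX// eY//; exact: XY'.
Qed.

Lemma independent_RVs_sym X Y : independent_RVs X Y -> independent_RVs Y X.
Proof. by move=> XY A B mA mB; rewrite setIC XY// muleC. Qed.

(** Open right rays are stable under intersection and generate the Borel sets. *)
Lemma eq_law_ray X Y :
  (forall h, P [set w | h < X w] = P [set w | h < Y w]) ->
  forall B, measurable B -> P (X @^-1` B) = P (Y @^-1` B).
Proof.
move=> XY B mB.
rewrite -[LHS]/(distribution P X B) -[RHS]/(distribution P Y B).
apply: (@measure_unique _ _ _ (@RGenOInfty.G R) (fun n => `]- n%:R, +oo[%classic)
  _ _ _ _ (distribution P X) (distribution P Y) _ _ B mB) => //.
- exact: RGenOInfty.measurableE.
- move=> _ _ [x ->] [y ->]; exists (Num.max x y).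
  by apply/seteqP; split => z /=; rewrite !in_itv/= !andbT gt_max;
    [move=> [-> ->]|move=> /andP].
- by move=> n; eexists.
- apply/seteqP; split => // x _; exists (Num.truncn `|x|).+1 => //=.
  rewrite in_itv/= andbT ltrNl; apply: le_lt_trans (Num.Theory.truncnS_gt _).
  by rewrite -normrN ler_norm.
- move=> _ [x ->].
  have rayE (Z : {RV P >-> R}) : distribution P Z `]x, +oo[ = P [set w | x < Z w].
    by congr (P _); apply/seteqP; split => w /=; rewrite in_itv/= andbT.
  exact: etrans (rayE X) (etrans (XY x) (esym (rayE Y))).
- by move=> n; rewrite (le_lt_trans (probability_le1 _ _))// ?ltry.
Qed.

End JointLaw.

Section CharacteristicFunctions.
Context d (T : measurableType d) (R : realType) (P : probability T R).
Implicit Types X Y : {RV P >-> R}.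

Lemma bmeas_cos_affine (X : T -> R) s r : measurable_fun setT X ->
  bounded_measurable (fun w => cos (s * X w + r)).
Proof.
by move=> mX; apply: bmeas_cos; apply: measurable_funD => //; exact: measurable_funM.
Qed.

Lemma measurable_ray (X : T -> R) h :
  measurable_fun setT X -> measurable [set w | h < X w].
Proof.
move=> mX; rewrite (_ : [set _ | _] = X @^-1` `]h, +oo[).
  by rewrite -[X in measurable X]setTI; exact: mX.
by apply/seteqP; split => w /=; rewrite in_itv/= andbT.
Qed.

Lemma bmeas_ray (X : T -> R) h : measurable_fun setT X ->
  bounded_measurable (fun w => (h < X w)%R%:R : R).
Proof.
move=> mX; have := bmeas_indic R (measurable_ray h mX).
congr bounded_measurable; apply/funext => w; rewrite indicE.
by congr (nat_of_bool _)%:R; apply/idP/idP; rewrite inE.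
Qed.

Lemma expect_ray (X : T -> R) h : measurable_fun setT X ->
  \int[P]_w (h < X w)%R%:R = fine (P [set w | h < X w]).
Proof.
move=> mX; rewrite -expect_indic; last exact: measurable_ray.
apply: eq_Rintegral => w _.
by rewrite indicE mem_setE.
Qed.

(** Cosine and sine expectations determine those of all trigonometric polynomials;
    [trig_closure_ray] carries the equality over to indicators of half-lines. *)
Lemma eq_ray_char (X Y : T -> R) :
  measurable_fun setT X -> measurable_fun setT Y ->
  (forall theta, \int[P]_w cos (theta * X w) = \int[P]_w cos (theta * Y w)) ->
  (forall theta, \int[P]_w sin (theta * X w) = \int[P]_w sin (theta * Y w)) ->
  forall h, P [set w | h < X w] = P [set w | h < Y w].
Proof.
move=> mX mY eqc eqs h.
have mray (Z : T -> R) : measurable_fun setT Z ->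
    P [set w | h < Z w] = (\int[P]_w (h < Z w)%R%:R)%:E.
  by move=> mZ; rewrite expect_ray// fineK// fin_num_measure//; exact: measurable_ray.
rewrite !mray//; congr _%:E.
apply: (@trig_closure_ray _ (fun f => \int[P]_w f (X w) = \int[P]_w f (Y w))).
  move=> _ [l ->]; rewrite /trig_sum !expect_sum; first last.
  - by move=> u; exact/bmeasZ/bmeas_cos_affine.
  - by move=> u; exact/bmeasZ/bmeas_cos_affine.
  apply: eq_bigr => u _; rewrite !expectZ;
    [|exact: bmeas_cos_affine|exact: bmeas_cos_affine].
  have E (Z : T -> R) : measurable_fun setT Z -> \int[P]_w cos (u.1.2 * Z w + u.2) =
      cos u.2 * (\int[P]_w cos (u.1.2 * Z w)) - sin u.2 * (\int[P]_w sin (u.1.2 * Z w)).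
    move=> mZ.
    have m : measurable_fun setT (fun w => u.1.2 * Z w) by exact: measurable_funM.
    rewrite -!expectZ; [|exact: bmeas_sin|exact: bmeas_cos].
    rewrite -expectB; [|exact/bmeasZ/bmeas_cos|exact/bmeasZ/bmeas_sin].
    by apply: eq_Rintegral => w _; rewrite cosD mulrC [X in _ - X]mulrC.
  by rewrite !E// eqc eqs.
move=> f_ f mf bf cf ef.
have cX (Z : T -> R) : measurable_fun setT Z ->
    \int[P]_w f_ n (Z w) @[n --> \oo] --> \int[P]_w f (Z w).
  move=> mZ; apply: (@bounded_convergence _ _ _ _ _ _ 1) => // n.
  exact: measurableT_comp.
rewrite -(cvg_lim _ (cX X mX))// -(cvg_lim _ (cX Y mY))//.
by congr (limn _); apply/funext.
Qed.

(** After expanding the cosine and factoring by independence, every term containing a sine of [X] or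
    [Y] vanishes. *)
Lemma expect_cos_indep X Y (s t r : R) : independent_RVs X Y ->
  (forall theta, \int[P]_w sin (theta * X w) = 0) ->
  (forall theta, \int[P]_w sin (theta * Y w) = 0) ->
  \int[P]_w cos (s * X w + t * Y w + r) =
  cos r * ((\int[P]_w cos (s * X w)) * (\int[P]_w cos (t * Y w))).
Proof.
move=> XY sX sY.
have bc (u : R) : bounded_measurable (fun x : R => cos (u * x)).
  by apply: bmeas_cos; exact: measurable_funM.
have bs (u : R) : bounded_measurable (fun x : R => sin (u * x)).
  by apply: bmeas_sin; exact: measurable_funM.
have bcZ (Z : {RV P >-> R}) u : bounded_measurable (fun w => cos (u * Z w)).
  by apply: bmeas_cos; exact: measurable_funM.
have bsZ (Z : {RV P >-> R}) u : bounded_measurable (fun w => sin (u * Z w)).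
  by apply: bmeas_sin; exact: measurable_funM.
have cc := expect_indep XY (bc s) (bc t); have ss := expect_indep XY (bs s) (bs t).
have sc := expect_indep XY (bs s) (bc t); have cs := expect_indep XY (bc s) (bs t).
rewrite -cc; transitivity (\int[P]_w
   (cos r * (cos (s * X w) * cos (t * Y w)) +
    (- cos r * (sin (s * X w) * sin (t * Y w)) +
    (- sin r * (sin (s * X w) * cos (t * Y w)) +
     - sin r * (cos (s * X w) * sin (t * Y w)))))).
  by apply: eq_Rintegral => w _; rewrite !cosD sinD; ring.
rewrite !expectD ?expectZ ?ss ?sc ?cs ?sX ?sY ?mul0r ?mulr0 ?addr0//;
  by repeat (apply: bmeasD || apply: bmeasZ || apply: bmeasM || exact: bcZ || exact: bsZ).
Qed.

Lemma std_sym_stableP alpha X : std_sym_stable alpha X -> forall theta,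
  \int[P]_w cos (theta * X w) = expR (- (`|theta| `^ alpha)) /\
  \int[P]_w sin (theta * X w) = 0.
Proof.
by move=> hX theta; have := hX theta; rewrite /char_fun unlock => -[].
Qed.

End CharacteristicFunctions.

(** * Nonnegative covariance of the pair when A <= B *)

Section StablePair.
Context d (T : measurableType d) (R : realType) (P : probability T R).
Variables (alpha a b : R) (S1 S2 : {RV P >-> R}).
Hypotheses (alpha_gt0 : 0 < alpha) (a_ge0 : 0 <= a) (b_ge0 : 0 <= b).
Hypothesis ab1 : a `^ alpha + b `^ alpha = 1.
Hypotheses (hS1 : std_sym_stable alpha S1) (hS2 : std_sym_stable alpha S2).
Hypothesis S12 : independent_RVs S1 S2.

Let X1 w := a * S1 w + b * S2 w.
Let X2 w := - a * S1 w + b * S2 w.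

Let phi (s : R) := expR (- (`|s| `^ alpha)).

(** Regrouping [s * X1 + t * X2] as [a (s - t) S1 + b (s + t) S2] separates the independent
    variables. The phase [r] lets the same formula give sine expectations. *)
Lemma expect_cos_pair s t r : \int[P]_w cos (s * X1 w + t * X2 w + r) =
  cos r * expR (- (a `^ alpha * `|s - t| `^ alpha + b `^ alpha * `|s + t| `^ alpha)).
Proof.
rewrite (eq_Rintegral _ (g := fun w =>
    cos ((a * (s - t)) * S1 w + (b * (s + t)) * S2 w + r))); last first.
  by move=> w _; congr cos; rewrite /X1 /X2; ring.
rewrite expect_cos_indep//; [|by move=> u; have [] := std_sym_stableP hS1 u
                             |by move=> u; have [] := std_sym_stableP hS2 u].
have [-> _] := std_sym_stableP hS1 (a * (s - t)).
have [-> _] := std_sym_stableP hS2 (b * (s + t)).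
rewrite -expRD -opprD (normrM a) (normrM b) (ger0_norm a_ge0) (ger0_norm b_ge0).
by rewrite (powRM _ a_ge0 (normr_ge0 _)) (powRM _ b_ge0 (normr_ge0 _)).
Qed.

Lemma expect_cos_X1 s r : \int[P]_w cos (s * X1 w + r) = cos r * phi s.
Proof.
have := expect_cos_pair s 0 r; under eq_Rintegral do rewrite mul0r addr0.
by move=> ->; rewrite subr0 addr0 -mulrDl ab1 mul1r.
Qed.

Lemma expect_cos_X2 s r : \int[P]_w cos (s * X2 w + r) = cos r * phi s.
Proof.
have := expect_cos_pair 0 s r; under eq_Rintegral do rewrite mul0r add0r.
by move=> ->; rewrite sub0r normrN add0r -mulrDl ab1 mul1r.
Qed.

Lemma measurable_X1 : measurable_fun setT X1.
Proof. by apply: measurable_funD; exact: measurable_funM. Qed.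

Lemma measurable_X2 : measurable_fun setT X2.
Proof. by apply: measurable_funD; exact: measurable_funM. Qed.

(** Two terms with frequencies s, t and phases r, r' contribute half of cos r cos r' (K(s, t) + K(s,
    -t)) + sin r sin r' (K(s, t) - K(s, -t)) to the covariance, up to their coefficients. Both
    kernels are positive semidefinite by [psd_reflect]. *)
Lemma cov_trig_ge0 (g : R -> R) : a `^ alpha <= b `^ alpha -> trig_poly g ->
  (\int[P]_w g (X1 w)) * (\int[P]_w g (X2 w)) <= \int[P]_w (g (X1 w) * g (X2 w)).
Proof.
move=> AB [l ->].
have b1 s r : bounded_measurable (fun w => cos (s * X1 w + r)).
  by apply: bmeas_cos_affine; exact: measurable_X1.
have b2 s r : bounded_measurable (fun w => cos (s * X2 w + r)).
  by apply: bmeas_cos_affine; exact: measurable_X2.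
have b12 s t r : bounded_measurable (fun w => cos (s * X1 w + t * X2 w + r)).
  apply: bmeas_cos; apply: measurable_funD => //; apply: measurable_funD.
    by apply: measurable_funM => //; exact: measurable_X1.
  by apply: measurable_funM => //; exact: measurable_X2.
have E1 : \int[P]_w trig_sum l (X1 w) = \sum_(u <- l) u.1.1 * (cos u.2 * phi u.1.2).
  rewrite expect_sum; last by move=> u; exact: bmeasZ.
  by apply: eq_bigr => u _; rewrite expectZ// expect_cos_X1.
have E2 : \int[P]_w trig_sum l (X2 w) = \sum_(u <- l) u.1.1 * (cos u.2 * phi u.1.2).
  rewrite expect_sum; last by move=> u; exact: bmeasZ.
  by apply: eq_bigr => u _; rewrite expectZ// expect_cos_X2.
pose K := stable_cov_kernel alpha (a `^ alpha) (b `^ alpha).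
have E12 : \int[P]_w (trig_sum l (X1 w) * trig_sum l (X2 w)) =
    \sum_(u <- l) \sum_(v <- l) u.1.1 * v.1.1 * (2^-1 *
      (cos (u.2 + v.2) * (K u.1.2 (- v.1.2) + phi u.1.2 * phi v.1.2) +
       cos (u.2 - v.2) * (K u.1.2 v.1.2 + phi u.1.2 * phi v.1.2))).
  transitivity (\int[P]_w (\sum_(u <- l) \sum_(v <- l) u.1.1 * v.1.1 * (2^-1 *
      (cos (u.1.2 * X1 w + v.1.2 * X2 w + (u.2 + v.2)) +
       cos (u.1.2 * X1 w + (- v.1.2) * X2 w + (u.2 - v.2)))))).
    apply: eq_Rintegral => w _; rewrite /trig_sum mulr_suml; apply: eq_bigr => u _.
    rewrite mulr_sumr; apply: eq_bigr => v _; rewrite mulrACA cosMcos.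
    by congr (_ * (_ * (cos _ + cos _))); ring.
  rewrite expect_sum; last first.
    by move=> u; apply: bmeas_sum => v; do 2 apply: bmeasZ; exact: bmeasD.
  apply: eq_bigr => u _; rewrite expect_sum; last first.
    by move=> v; do 2 apply: bmeasZ; exact: bmeasD.
  apply: eq_bigr => v _; rewrite !expectZ ?expectD//; [|exact: bmeasD|].
    rewrite !expect_cos_pair /K /stable_cov_kernel normrN opprK.
    by congr (_ * (_ * (_ * _ + _ * _))); rewrite subrK// addrC.
  by apply: bmeasZ; exact: bmeasD.
rewrite E1 E2 E12 -subr_ge0.
have psdK : psd K.
  apply: (@psd_stable_cov_kernel _ _ _ P _ _ _ S1) => // u.
  by have [] := std_sym_stableP hS1 u.
have KN s t : K (- s) (- t) = K s t by exact: stable_cov_kernelN.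
have sqN1 : (-1) ^+ 2 = 1 :> R by rewrite sqrrN expr1n.
have := psd_reflect (expr1n _ 2) KN psdK [seq (u.1.1 * cos u.2, u.1.2) | u <- l].
have := psd_reflect sqN1 KN psdK [seq (u.1.1 * sin u.2, u.1.2) | u <- l].
move=> hs hc; have := addr_ge0 hc hs.
rewrite !big_map -big_split /= -(pmulr_rge0 _ (_ : 0 < 2^-1 :> R))// mulr_sumr.
congr (0 <= _); rewrite mulr_suml -sumrB; apply: eq_bigr => u _.
rewrite !big_map mulr_sumr -sumrB -big_split /= mulr_sumr; apply: eq_bigr => v _.
rewrite cosD cosB; move: (K u.1.2 v.1.2) (K u.1.2 (- v.1.2)) (phi u.1.2) (phi v.1.2).
by move: (cos u.2) (cos v.2) (sin u.2) (sin v.2) => *; field.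
Qed.

Lemma cov_ray_ge0 h : a `^ alpha <= b `^ alpha ->
  fine (P [set w | h < X1 w]) * fine (P [set w | h < X2 w]) <=
  fine (P [set w | h < X1 w /\ h < X2 w]).
Proof.
move=> AB; have m1 := measurable_X1; have m2 := measurable_X2.
have -> : fine (P [set w | h < X1 w /\ h < X2 w]) =
    \int[P]_w ((h < X1 w)%R%:R * (h < X2 w)%R%:R).
  (* Joint exceedance is exceedance by the minimum, so [expect_ray] applies to it. *)
  rewrite (_ : [set _ | _] = [set w | h < Num.min (X1 w) (X2 w)]); last first.
    by apply/seteqP; split => w /=; rewrite lt_min => /andP.
  rewrite -expect_ray; last exact: measurable_minr.
  by apply: eq_Rintegral => w _; rewrite lt_min -mulnb natrM.
rewrite -!expect_ray//.
apply: (@trig_closure_ray _ (fun f =>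
  (\int[P]_w f (X1 w)) * (\int[P]_w f (X2 w)) <= \int[P]_w (f (X1 w) * f (X2 w)))).
  by move=> g; exact: cov_trig_ge0.
move=> f_ f mf bf cf le_f.
have c1 : \int[P]_w f_ n (X1 w) @[n --> \oo] --> \int[P]_w f (X1 w).
  by apply: (@bounded_convergence _ _ _ _ _ _ 1) => // n; exact: measurableT_comp.
have c2 : \int[P]_w f_ n (X2 w) @[n --> \oo] --> \int[P]_w f (X2 w).
  by apply: (@bounded_convergence _ _ _ _ _ _ 1) => // n; exact: measurableT_comp.
have c12 : \int[P]_w (f_ n (X1 w) * f_ n (X2 w)) @[n --> \oo] -->
    \int[P]_w (f (X1 w) * f (X2 w)).
  apply: (@bounded_convergence _ _ _ _ _ _ 1) => [n|n w|w].
  - by apply: measurable_funM; exact: measurableT_comp.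
  - by rewrite normrM mulr_ile1.
  - by apply: cvgM; exact: cf.
have c : (\int[P]_w f_ n (X1 w)) * (\int[P]_w f_ n (X2 w)) @[n --> \oo] -->
    (\int[P]_w f (X1 w)) * (\int[P]_w f (X2 w)) by exact: cvgM.
rewrite -(cvg_lim _ c)// -(cvg_lim _ c12)//; apply: ler_lim.
- by apply/cvg_ex; eexists; exact: c.
- by apply/cvg_ex; eexists; exact: c12.
- exact: nearW.
Qed.

End StablePair.

(** * Two-point color processes *)

Section TwoPointColorProcesses.
Variable R : realType.

Lemma forall_ord2 (Q : 'I_2 -> Prop) : (forall i, Q i) <-> Q ord0 /\ Q ord_max.
Proof.
split=> [h|[h0 h1] i]; first by split; exact: h.
by have [->|->] : i = ord0 \/ i = ord_max;
  [case: i => [[|[|//]] ?]; [left|right]; exact: val_inj | |].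
Qed.

(** Moving the two constraints into the factors makes the sum of products a product of sums, in
    which each unconstrained set contributes [p + (1 - p) = 1]. *)
Lemma sum_colorings (D : finType) (p : R) (B0 B1 : D) (y0 y1 : bool) :
  \sum_(c : {ffun D -> bool} | (c B0 == y0) && (c B1 == y1))
    \prod_B bern_weight p (c B) =
  if B0 == B1 then (y0 == y1)%:R * bern_weight p y0
  else bern_weight p y0 * bern_weight p y1.
Proof.
pose F B (b : bool) : R := ((B == B0) ==> (b == y0))%:R *
  ((B == B1) ==> (b == y1))%:R * bern_weight p b.
rewrite big_mkcond (eq_bigr (fun c : {ffun D -> bool} => \prod_B F B (c B))); last first.
  move=> c _; case: ifPn => [/andP[/eqP c0 /eqP c1]|].
    apply: eq_bigr => B _; rewrite /F.
    have -> : (B == B0) ==> (c B == y0) by apply/implyP => /eqP ->; rewrite c0.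
    have -> : (B == B1) ==> (c B == y1) by apply/implyP => /eqP ->; rewrite c1.
    by rewrite !mul1r.
  rewrite negb_and => /orP[] /negbTE cF.
    by rewrite (bigD1 B0)//= /F eqxx cF !mul0r.
  by rewrite (bigD1 B1)//= /F eqxx cF mulr0 !mul0r.
rewrite -bigA_distr_bigA /=.
have sumF B : \sum_b F B b = F B true + F B false by rewrite big_bool.
have F1 B : B != B0 -> B != B1 -> \sum_b F B b = 1.
  by move=> /negbTE n0 /negbTE n1; rewrite sumF /F n0 n1 /= !mul1r addrC subrK.
rewrite (bigD1 B0)//=; case: ifPn => [/eqP e01|n01].
  subst B1.
  rewrite [X in _ * X]big1 => [|B nB]; last exact: F1.
  rewrite sumF /F eqxx mulr1.
  by case: (y0); case: (y1); rewrite /= ?(mul0r, mul1r, mulr0, mulr1, addr0, add0r).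
rewrite (bigD1 B1)/=; last by rewrite eq_sym.
rewrite [X in _ * (_ * X)]big1 => [|B /andP[n0 n1]]; last exact: F1.
rewrite !sumF /F !eqxx (eq_sym B1) (negbTE n01) mulr1.
by case: (y0); case: (y1); rewrite /= ?(mul0r, mul1r, mulr0, mulr1, addr0, add0r).
Qed.

Definition joined (pi : {set {set 'I_2}}) : bool :=
  finset.pblock pi ord0 == finset.pblock pi ord_max.

Lemma color_lawE (p : R) (q : {set {set 'I_2}} -> R) (y : 'I_2 -> bool) :
  color_law p q y =
  \sum_(pi | finset.partition pi (finset.setTfor 'I_2)) q pi *
    if joined pi then (y ord0 == y ord_max)%:R * bern_weight p (y ord0)
    else bern_weight p (y ord0) * bern_weight p (y ord_max).
Proof.
apply: eq_bigr => pi _; rewrite -mulr_sumr -sum_colorings; congr (_ * _).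
apply: eq_bigl => c; apply/forallP/andP => [h|[h0 h1]]; first by split; exact: h.
exact/forall_ord2.
Qed.

Context d (T : measurableType d) (P : probability T R).

(** Two points are either joined or separated, so a color process is a mixture of equal and
    independent Bernoulli variables; its covariance is the weight of joining times [p (1 - p)].
    Conversely, this weight is recovered as covariance over variance. *)
Lemma color_process_pairP (Y : 'I_2 -> T -> bool) :
  (forall i, measurable [set w | Y i w]) ->
  color_process P Y <->
  fine (P [set w | Y ord0 w]) = fine (P [set w | Y ord_max w]) /\
  fine (P [set w | Y ord0 w]) * fine (P [set w | Y ord_max w]) <=
  fine (P [set w | Y ord0 w /\ Y ord_max w]).
Proof.
move=> mY.
pose A0 := [set w | Y ord0 w]; pose A1 := [set w | Y ord_max w].
have mA0 : measurable A0 by exact: mY.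
have mA1 : measurable A1 by exact: mY.
pose p0 := fine (P A0); pose p1 := fine (P A1); pose p01 := fine (P (A0 `&` A1)).
pose J (y0 y1 : bool) : R := if y0 then (if y1 then p01 else p0 - p01)
  else (if y1 then p1 - p01 else 1 - p0 - p1 + p01).
have b0 := bmeas_indic R mA0; have b1 := bmeas_indic R mA1.
have lawE y : P [set w | forall i, Y i w = y i] = (J (y ord0) (y ord_max))%:E.
  (* At an indicator value, [bern_weight] is the indicator of [A] or of its complement, according to
     [b]. *)
  pose I (A : set T) (b : bool) (w : T) : R := bern_weight (\1_A w) b.
  have -> : [set w | forall i, Y i w = y i] =
      [set w | Y ord0 w = y ord0] `&` [set w | Y ord_max w = y ord_max].
    by apply/seteqP; split=> w /= h; apply/(forall_ord2 (fun i => Y i w = y i)).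
  have mE i : measurable [set w | Y i w = y i].
    case: (y i); first exact: mY.
    rewrite (_ : [set _ | _] = ~` [set w | Y i w]); first exact/measurableC/mY.
    by apply/seteqP; split=> w /=; case: (Y i w).
  have mE01 := measurableI _ _ (mE ord0) (mE ord_max).
  rewrite -[LHS]fineK ?fin_num_measure// -expect_indic//; congr _%:E.
  rewrite (eq_Rintegral _
    (g := fun w => I A0 (y ord0) w * I A1 (y ord_max) w)); last first.
    move=> w _; rewrite /I !indicE !in_setI.
    have memE i b : (w \in [set w | Y i w = b]) = (Y i w == b).
      by apply/idP/eqP; rewrite inE.
    rewrite !memE.
    by case: (Y ord0 w); case: (Y ord_max w); case: (y ord0); case: (y ord_max);
      rewrite /bern_weight ?(subrr, subr0, mulr0, mul0r, mulr1).
  have b01 : bounded_measurable (fun w => \1_A0 w * \1_A1 w : R) by exact: bmeasM.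
  have E01 : \int[P]_w (\1_A0 w * \1_A1 w) = p01.
    rewrite /p01 -expect_indic; last exact: measurableI.
    by apply: eq_Rintegral => w _; rewrite indicI.
  have E0 : \int[P]_w \1_A0 w = p0 by exact: expect_indic.
  have E1 : \int[P]_w \1_A1 w = p1 by exact: expect_indic.
  have bc := bmeas_cst T (1 : R).
  rewrite /I /J; case: (y ord0); case: (y ord_max) => /=.
  - exact: E01.
  - rewrite -E0 -E01 -expectB//; apply: eq_Rintegral => w _; ring.
  - rewrite -E1 -E01 -expectB//; apply: eq_Rintegral => w _; ring.
  - rewrite -E0 -E1 -E01 -[X in X - _ - _ + _](expect_cst P) -!expectB//.
      rewrite -expectD//; first by apply: eq_Rintegral => w _; ring.
      by apply: bmeasB => //; exact: bmeasB.
    exact: bmeasB.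
have p0_01 : 0 <= p0 <= 1.
  rewrite /p0 fine_ge0//= -lee_fin fineK ?fin_num_measure//; exact: probability_le1.
have p01_le : p01 <= p0.
  have mA01 := measurableI _ _ mA0 mA1.
  by rewrite fine_le ?fin_num_measure// le_measure ?inE.
split.
  move=> [p [q [/andP[p_ge0 p_le1] [q_ge0 q1] hq]]].
  have {}hq y : J (y ord0) (y ord_max) = color_law p q y.
    by apply: EFin_inj; rewrite -lawE hq.
  pose yy (y0 y1 : bool) (i : 'I_2) := if i == ord0 then y0 else y1.
  have H y0 y1 := hq (yy y0 y1).
  (* Both marginals equal [p] because each partition separately gives the value [p]. *)
  have marg (x : R) (W : {set {set 'I_2}} -> R) : (forall pi, W pi = x) ->
      \sum_(pi | finset.partition pi (finset.setTfor 'I_2)) q pi * W pi = x.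
    by move=> Wx; under eq_bigr do rewrite Wx; rewrite -mulr_suml q1 mul1r.
  have e0 : p0 = p.
    have -> : p0 = J true true + J true false by rewrite /J addrC subrK.
    rewrite -/(J (yy true true ord0) (yy true true ord_max)) H.
    rewrite -/(J (yy true false ord0) (yy true false ord_max)) H.
    rewrite !color_lawE -big_split/=; under eq_bigr do rewrite -mulrDr.
    by apply: marg => pi; case: ifP => _; rewrite /yy/=; ring.
  have e1 : p1 = p.
    have -> : p1 = J true true + J false true by rewrite /J addrC subrK.
    rewrite -/(J (yy true true ord0) (yy true true ord_max)) H.
    rewrite -/(J (yy false true ord0) (yy false true ord_max)) H.
    rewrite !color_lawE -big_split/=; under eq_bigr do rewrite -mulrDr.
    by apply: marg => pi; case: ifP => _; rewrite /yy/=; ring.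
  rewrite -/A0 -/A1 -/p0 -/p1 e0 e1; split => //.
  have -> : fine (P [set w | Y ord0 w /\ Y ord_max w]) = color_law p q (yy true true).
    exact: (H true true).
  rewrite -[leLHS](marg _ (fun=> p * p))// color_lawE; apply: ler_sum => pi /q_ge0 qpi.
  apply: ler_wpM2l => //; case: ifP => _ //=.
  by rewrite /yy/= mul1r -[leRHS]mulr1 ler_wpM2l.
rewrite -/A0 -/A1 -/p0 -/p1 -/p01 => -[e01 cov]; rewrite -e01 in cov.
(* When [p0] is 0 or 1 this is 0 by the junk value of division. *)
pose t := (p01 - p0 * p0) / (p0 - p0 * p0).
have var_ge0 : 0 <= p0 - p0 * p0 by nra.
have tE : t * (p0 - p0 * p0) = p01 - p0 * p0.
  have [v0|v0] := eqVneq (p0 - p0 * p0) 0; last by rewrite /t divfK.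
  (* With zero variance, [p0 * p0 <= p01 <= p0] forces the covariance to vanish too. *)
  rewrite v0 mulr0; nra.
have t01 : 0 <= t <= 1.
  rewrite /t divr_ge0//= ?subr_ge0//.
  have [->|v0] := eqVneq (p0 - p0 * p0) 0; first by rewrite invr0 mulr0.
  by rewrite ler_pdivrMr ?lt_neqAle ?(eq_sym 0) ?v0//; lra.
(* The one-block partition gets weight [t], the partition into singletons [1 - t]. *)
pose pi0 := finset.equivalence_partition (fun _ _ : 'I_2 => true) (finset.setTfor 'I_2).
pose pi1 := finset.equivalence_partition (fun i j : 'I_2 => i == j) (finset.setTfor 'I_2).
have eqv0 : {in finset.setTfor 'I_2 & &, equivalence_rel (fun _ _ : 'I_2 => true)} by [].
have eqv1 : {in finset.setTfor 'I_2 & &, equivalence_rel (fun i j : 'I_2 => i == j)}.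
  by move=> i j k _ _ _; split => // /eqP ->.
have part0 := finset.equivalence_partitionP eqv0.
have part1 := finset.equivalence_partitionP eqv1.
have join0 : joined pi0.
  rewrite /joined finset.eq_pblock ?(finset.partition_trivIset part0)//.
    by rewrite (finset.pblock_equivalence_partition eqv0) ?finset.inE.
  by rewrite (finset.cover_partition part0) finset.inE.
have join1 : joined pi1 = false.
  rewrite /joined finset.eq_pblock ?(finset.partition_trivIset part1)//.
    by rewrite (finset.pblock_equivalence_partition eqv1) ?finset.inE.
  by rewrite (finset.cover_partition part1) finset.inE.
pose q pi := t * (pi == pi0)%:R + (1 - t) * (pi == pi1)%:R.
have qsum (W : {set {set 'I_2}} -> R) :
    \sum_(pi | finset.partition pi (finset.setTfor 'I_2)) q pi * W pi =
    t * W pi0 + (1 - t) * W pi1.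
  rewrite (eq_bigr (fun pi => t * ((pi == pi0)%:R * W pi) +
      (1 - t) * ((pi == pi1)%:R * W pi))); last by move=> pi _; rewrite /q; ring.
  rewrite big_split/= -!mulr_sumr (bigD1 pi0)//= eqxx mul1r big1 ?addr0; last first.
    by move=> pi /andP[_ /negbTE ->]; rewrite mul0r.
  rewrite (bigD1 pi1)//= eqxx mul1r big1 ?addr0// => pi /andP[_ /negbTE ->].
  by rewrite mul0r.
exists p0, q; split => //.
  split=> [pi _|].
    by rewrite /q addr_ge0// mulr_ge0//; lra.
  have := qsum (fun=> 1); under eq_bigr do rewrite mulr1.
  by move=> ->; rewrite !mulr1 addrC subrK.
move=> y; rewrite lawE color_lawE qsum join0 join1 /J /bern_weight -e01.
congr _%:E; case: (y ord0); case: (y ord_max) => /=; lra.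
Qed.

End TwoPointColorProcesses.

(** * The four cones *)

Section NoAtom.
Context d (T : measurableType d) (R : realType) (P : probability T R).
Variables (alpha : R) (Z : T -> R).
Hypotheses (alpha_gt0 : 0 < alpha) (mZ : measurable_fun setT Z).
Hypothesis cosZ : forall theta,
  \int[P]_w cos (theta * Z w) = expR (- (`|theta| `^ alpha)).

Lemma measurable_zero : measurable [set w | Z w = 0].
Proof.
rewrite (_ : [set _ | _] = Z @^-1` [set 0]).
  by rewrite -[X in measurable X]setTI; exact: mZ.
by apply/seteqP; split.
Qed.

(* A Fejer-type bound: [n^2 1_{Z = 0} <= (\sum_(k < n) cos ((k + 1) theta Z))^2]. *)
Lemma atom0_bound (theta : R) (n : nat) : 0 <= theta ->
  fine (P [set w | Z w = 0]) * n.+1%:R ^+ 2 <=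
  n.+1%:R ^+ 2 * expR (- (theta `^ alpha)) + n.+1%:R.
Proof.
move=> th0; set N := n.+1; pose e := expR (- (theta `^ alpha)) : R.
have mA := measurable_zero.
(* Starting the frequencies at 1 keeps every sum [j.+1 + k.+1] away from 0, so only the differences
   with [j = k] escape the bound [e]. *)
pose c (k : nat) w := cos (k.+1%:R * theta * Z w).
have bcos (s : R) : bounded_measurable (fun w => cos (s * Z w)).
  by apply: bmeas_cos; exact: measurable_funM.
pose phi (s : R) := expR (- (`|s| `^ alpha)).
have phi_le (s : R) : 1 <= `|s| -> phi (s * theta) <= e.
  move=> s1; rewrite /phi ler_expR lerN2 normrM (ger0_norm th0).
  by apply: (ge0_ler_powR (ltW alpha_gt0)); rewrite ?nnegrE ?mulr_ge0// ler_peMl.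
have phi_le1 s : phi s <= 1 by rewrite /phi expR_le1 oppr_le0 powR_ge0.
have cosj j k : \int[P]_w (c j w * c k w) <= e + (j == k)%:R.
  rewrite (eq_Rintegral _ (g := fun w => 2^-1 *
      (cos (((j.+1 + k.+1)%:R * theta) * Z w) +
       cos (((j.+1%:R - k.+1%:R) * theta) * Z w)))); last first.
    move=> w _; rewrite /c cosMcos natrD; congr (_ * (cos _ + cos _)); ring.
  rewrite expectZ; last exact: bmeasD.
  rewrite expectD// !cosZ.
  have h1 : phi ((j.+1 + k.+1)%:R * theta) <= e.
    by apply: phi_le; rewrite normr_nat ler1n.
  have h2 : phi ((j.+1%:R - k.+1%:R) * theta) <= e + (j == k)%:R *+ 2.
    have [->|jk] := eqVneq j k.
      apply: le_trans (phi_le1 _) _; have := expR_ge0 (- (theta `^ alpha)).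
      rewrite -/e /= mulr1n mulr2n; lra.
    rewrite mul0rn addr0; apply: phi_le.
    wlog {jk} lt_jk : j k {h1} / (j < k)%N.
      move=> H; have [lt|lt|eq] := ltngtP j k; first exact: H.
        by rewrite distrC; exact: H.
      by rewrite eq eqxx in jk.
    rewrite distrC ger0_norm; first by rewrite lerBrDr nat1r ler_nat.
    by rewrite subr_ge0 ler_nat ltnW.
  rewrite -/(phi ((j.+1 + k.+1)%:R * theta)) -/(phi ((j.+1%:R - k.+1%:R) * theta)).
  by move: (phi _) (phi _) (j == k)%:R h1 h2 => p1 p2 x; rewrite mulr2n; lra.
have bF : bounded_measurable (fun w => (\sum_(k <- index_iota 0 N) c k w) ^+ 2).
  have b : bounded_measurable (fun w => \sum_(k <- index_iota 0 N) c k w).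
    by apply: bmeas_sum => k; exact: bcos.
  by under eq_fun do rewrite expr2; exact: bmeasM.
rewrite mulrC -(expect_indic P mA) -expectZ; last exact: bmeas_indic.
apply: (@le_trans _ _ (\int[P]_w (\sum_(k <- index_iota 0 N) c k w) ^+ 2)).
  apply: expect_le => //; first by apply: bmeasZ; exact: bmeas_indic.
  move=> w; rewrite indicE; have [wA|] := boolP (w \in _); last by rewrite mulr0 sqr_ge0.
  move: wA; rewrite inE /= => Zw0; rewrite mulr1.
  under eq_bigr do rewrite /c Zw0 mulr0 cos0.
  by rewrite sumr_const_nat subn0 -mulr_natl mulr1.
rewrite (eq_Rintegral _ (g := fun w =>
    \sum_(j <- index_iota 0 N) \sum_(k <- index_iota 0 N) c j w * c k w)); last first.
  by move=> w _; rewrite expr2 mulr_suml; apply: eq_bigr => j _; rewrite mulr_sumr.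
have bcc j k : bounded_measurable (fun w => c j w * c k w) by apply: bmeasM; exact: bcos.
rewrite expect_sum; last by move=> j; exact: bmeas_sum.
apply: (@le_trans _ _ (\sum_(j <- index_iota 0 N) (N%:R * e + 1))).
  rewrite big_seq [leRHS]big_seq; apply: ler_sum => j jN; rewrite expect_sum//.
  apply: (@le_trans _ _ (\sum_(k <- index_iota 0 N) (e + (j == k)%:R))).
    by apply: ler_sum => k _; exact: cosj.
  rewrite big_split /= sumr_const_nat subn0 mulr_natl lerD2l.
  rewrite (bigD1_seq j) ?iota_uniq//= eqxx big1 ?addr0// => k.
  by rewrite eq_sym => /negbTE ->.
rewrite sumr_const_nat subn0 -[leLHS]mulr_natl mulrDr mulr1 mulrA -expr2.
by rewrite lerD2r mulrC.
Qed.

Lemma no_atom0 : fine (P [set w | Z w = 0]) = 0.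
Proof.
apply/eqP; rewrite eq_le fine_ge0// andbT; set p := fine _.
have bnd n : p <= expR (- n.+1%:R) + n.+1%:R^-1.
  have n0 : 0 < n.+1%:R :> R by rewrite ltr0n.
  (* This choice makes [theta ^ alpha = n.+1], so both error terms vanish in the limit. *)
  have := @atom0_bound (n.+1%:R `^ alpha^-1) n (powR_ge0 _ _).
  rewrite -powRrM mulVf ?gt_eqF// (powRr1 (ltW n0)) -/p => h.
  rewrite -(ler_pM2r (exprn_gt0 2 n0)); apply: le_trans h _.
  by rewrite mulrDl (mulrC (expR _)) lerD2l expr2 mulrA mulVf ?mul1r// gt_eqF.
have c : expR (- n.+1%:R) + n.+1%:R^-1 @[n --> \oo] --> (0 + 0 : R).
  apply: cvgD; last exact: cvg_harmonic.
  have := @cvgn_expR R; rewrite -cvg_shiftS; exact.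
rewrite -[leRHS](addr0 0) -(cvg_lim _ c)//; apply: limr_ge.
  by apply/cvg_ex; eexists; exact: c.
exact: nearW.
Qed.

End NoAtom.

(** * Signs of the pair at threshold 0 and symmetries of (S1, S2) *)

Section StablePairSigns.
Context d (T : measurableType d) (R : realType) (P : probability T R).
Variables (alpha a b : R) (S1 S2 : {RV P >-> R}).
Hypotheses (alpha_gt0 : 0 < alpha) (a_ge0 : 0 <= a) (b_gt0 : 0 < b).
Hypothesis ab1 : a `^ alpha + b `^ alpha = 1.
Hypotheses (hS1 : std_sym_stable alpha S1) (hS2 : std_sym_stable alpha S2).
Hypothesis S12 : independent_RVs S1 S2.

Let b_ge0 : 0 <= b := ltW b_gt0.
Let X1 w := a * S1 w + b * S2 w.
Let X2 w := - a * S1 w + b * S2 w.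

Let mX1 : measurable_fun setT X1 := measurable_X1 a b S1 S2.
Let mX2 : measurable_fun setT X2 := measurable_X2 a b S1 S2.

Let cosX1 theta : \int[P]_w cos (theta * X1 w) = expR (- (`|theta| `^ alpha)).
Proof.
have := expect_cos_X1 a_ge0 b_ge0 ab1 hS1 hS2 S12 theta 0.
by under eq_Rintegral do rewrite addr0; rewrite cos0 mul1r.
Qed.

Let cosX2 theta : \int[P]_w cos (theta * X2 w) = expR (- (`|theta| `^ alpha)).
Proof.
have := expect_cos_X2 a_ge0 b_ge0 ab1 hS1 hS2 S12 theta 0.
by under eq_Rintegral do rewrite addr0; rewrite cos0 mul1r.
Qed.

Let sinX1 theta : \int[P]_w sin (theta * X1 w) = 0.
Proof.
have := expect_cos_X1 a_ge0 b_ge0 ab1 hS1 hS2 S12 theta (- (pi / 2)).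
by under eq_Rintegral do rewrite cosBpihalf; rewrite cosN cos_pihalf mul0r.
Qed.

Let sinX2 theta : \int[P]_w sin (theta * X2 w) = 0.
Proof.
have := expect_cos_X2 a_ge0 b_ge0 ab1 hS1 hS2 S12 theta (- (pi / 2)).
by under eq_Rintegral do rewrite cosBpihalf; rewrite cosN cos_pihalf mul0r.
Qed.

Lemma eq_ray_pair h : P [set w | h < X1 w] = P [set w | h < X2 w].
Proof. by apply: eq_ray_char => // u; rewrite ?cosX1 ?cosX2 ?sinX1 ?sinX2. Qed.

(** [X1] is symmetric without an atom at 0, so the two open half-lines share the mass equally. *)
Lemma prob_X1_gt0 : fine (P [set w | 0 < X1 w]) = 2^-1.
Proof.
have mN : measurable_fun setT (fun w => - X1 w) by exact: measurable_funN.
have sym : P [set w | 0 < X1 w] = P [set w | 0 < - X1 w].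
  apply: eq_ray_char => // u.
    by apply: eq_Rintegral => w _; rewrite mulrN cosN.
  have b1 : bounded_measurable (fun w => sin (u * X1 w)).
    by apply: bmeas_sin; exact: measurable_funM.
  under [RHS]eq_Rintegral do rewrite mulrN sinN -mulN1r.
  by rewrite expectZ// sinX1 mulr0.
have m0 := measurable_zero mX1.
have /eqP := expect_cst P (1 : R).
rewrite (eq_Rintegral _ (g := fun w => (0 < X1 w)%R%:R + (0 < - X1 w)%R%:R +
    \1_[set w | X1 w = 0] w)); last first.
  move=> w _; rewrite indicE oppr_gt0.
  have -> : (w \in [set w | X1 w = 0]) = (X1 w == 0) by apply/idP/eqP; rewrite inE.
  by case: (ltgtP (X1 w) 0) => _; rewrite ?(addr0, add0r).
rewrite !expectD; [|exact: bmeas_ray|exact: bmeas_ray| |exact: bmeas_indic]; last first.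
  by apply: bmeasD; exact: bmeas_ray.
rewrite !expect_ray// expect_indic// -sym.
have /= -> := no_atom0 alpha_gt0 mX1 cosX1.
by move=> /eqP; lra.
Qed.

Let lawS : forall B, measurable B -> P (S1 @^-1` B) = P (S2 @^-1` B).
Proof.
apply: eq_law_ray => h; apply: eq_ray_char => // u;
  have [c1 s1] := std_sym_stableP hS1 u; have [c2 s2] := std_sym_stableP hS2 u.
  by rewrite c1 c2.
by rewrite s1 s2.
Qed.

(** Negation is taken among measurable functions, so that the result is again a random variable. *)
Let opp_RV (X : {RV P >-> R}) : {RV P >-> R} := - (X : {mfun T >-> R}).

Let opp_RVE (X : {RV P >-> R}) w : opp_RV X w = - X w.
Proof. by rewrite /opp_RV mfunN. Qed.

Let law_opp (X : {RV P >-> R}) : std_sym_stable alpha X ->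
  forall B, measurable B -> P (X @^-1` B) = P (opp_RV X @^-1` B).
Proof.
move=> hX; apply: eq_law_ray => h; apply: eq_ray_char => // u.
  by apply: eq_Rintegral => w _; rewrite opp_RVE mulrN cosN.
have b1 : bounded_measurable (fun w => sin (u * X w)).
  by apply: bmeas_sin; exact: measurable_funM.
have [_ s] := std_sym_stableP hX u.
transitivity (\int[P]_w (-1 * sin (u * X w))).
  by rewrite expectZ// s mulr0.
by apply: eq_Rintegral => w _; rewrite opp_RVE mulrN sinN mulN1r.
Qed.

Let indep_opp (X Y : {RV P >-> R}) : independent_RVs X Y -> independent_RVs X (opp_RV Y).
Proof.
move=> XY A B mA mB.
have mNB : measurable (-%R @^-1` B).
  rewrite -[X in measurable X]setTI.
  exact: (measurable_funN (@measurable_id _ R setT) measurableT mB).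
have -> : opp_RV Y @^-1` B = Y @^-1` (-%R @^-1` B).
  by apply/funext => w; rewrite /preimage /mkset opp_RVE.
exact: XY.
Qed.

Let cone : set (R * R) := [set z | 0 < b * z.2 - a * `|z.1|].

Let mcone : measurable cone.
Proof.
apply: (@measurable_ray _ _ _ (fun z : R * R => b * z.2 - a * `|z.1|)).
apply: measurable_funB; apply: measurable_funM => //.
exact: measurableT_comp.
Qed.

Let cone_prob := fine (P [set w | 0 < b * S2 w - a * `|S1 w|]).

(** The smaller of [a x + b y] and [- a x + b y] is b y - a |x|. *)
Let cone_lt (x y : R) :
  (0 < a * x + b * y /\ 0 < - a * x + b * y) <-> 0 < b * y - a * `|x|.
Proof.
have [x0|x0] := leP 0 x.
  by rewrite ger0_norm//; have := mulr_ge0 a_ge0 x0; split=> [[]|]; [lra|split; lra].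
rewrite ltr0_norm//; have := mulr_ge0 a_ge0 (ltW (_ : 0 < - x)).
rewrite oppr_gt0 => /(_ x0).
by split=> [[]|]; [lra|split; lra].
Qed.

Lemma prob_quadrantE : fine (P [set w | 0 < X1 w /\ 0 < X2 w]) = cone_prob.
Proof.
by congr (fine (P _)); apply/seteqP; split => w /=; rewrite /X1 /X2; move/cone_lt.
Qed.

Let coneE (X Y X' Y' : {RV P >-> R}) : independent_RVs X Y -> independent_RVs X' Y' ->
  (forall B, measurable B -> P (X @^-1` B) = P (X' @^-1` B)) ->
  (forall B, measurable B -> P (Y @^-1` B) = P (Y' @^-1` B)) ->
  P [set w | 0 < b * Y w - a * `|X w|] = P [set w | 0 < b * Y' w - a * `|X' w|].
Proof. by move=> XY XY' eX eY; exact: (eq_joint_law XY XY' eX eY mcone). Qed.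

(* If [b < a], the cone [b y > a |x|] and its images under exchange and sign change of
   the coordinates are disjoint and miss the box [q < |x|, |y| < (a / b) q]. *)
Lemma cones_box_disjoint (q x y : R) : b < a -> 0 < q ->
  (0 < b * y - a * `|x|)%R%:R + (0 < b * - y - a * `|x|)%R%:R +
  (0 < b * x - a * `|y|)%R%:R + (0 < b * - x - a * `|y|)%R%:R +
  ((q < `|x| < a / b * q) && (q < `|y| < a / b * q))%:R <= 1 :> R.
Proof.
move=> ba q0; have a0 : 0 < a by exact: lt_trans ba.
have bx : b * x <= b * `|x| by rewrite ler_pM2l// ler_norm.
have by_ : b * y <= b * `|y| by rewrite ler_pM2l// ler_norm.
have bNx : b * - x <= b * `|x| by rewrite ler_pM2l// -normrN ler_norm.
have bNy : b * - y <= b * `|y| by rewrite ler_pM2l// -normrN ler_norm.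
have abx : b * `|x| <= a * `|x| by rewrite ler_wpM2r// ltW.
have aby : b * `|y| <= a * `|y| by rewrite ler_wpM2r// ltW.
have b0x : 0 <= b * `|x| by rewrite mulr_ge0.
have b0y : 0 <= b * `|y| by rewrite mulr_ge0.
(* For [z] and [z'] in the interval, [b * z < a * q < a * z'], so no cone inequality can hold on the
   box. *)
have box z : q < z < a / b * q -> a * q < a * z /\ b * z < a * q.
  move=> /andP[qz zr]; split; first by rewrite ltr_pM2l.
  have -> : a * q = b * (a / b * q) by field; rewrite gt_eqF.
  by rewrite ltr_pM2l.
have ind (c : bool) : (nat_of_bool c)%:R = if c then 1 else 0 :> R by case: c.
rewrite !ind; rewrite !mulrN in bNx bNy *.
move: (q < `|x| < _) (q < `|y| < _) (box `|x|) (box `|y|) => cx cy boxx boxy.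
move: (b * x) (b * y) (b * `|x|) (b * `|y|) (a * `|x|) (a * `|y|) (a * q)
  bx by_ bNx bNy abx aby b0x b0y boxx boxy => {box ind ba q0 a0}.
move=> bx by' nbx nby nax nay aq bx_le by_le bNx_le bNy_le abx aby b0x b0y boxx boxy.
case: ifP => [h1|_]; case: ifP => [h2|_]; case: ifP => [h3|_]; case: ifP => [h4|_];
  case: ifP => [/andP[/boxx[? ?] /boxy[? ?]]|_]; clear boxx boxy; lra.
Qed.

Let annulus (q : R) := [set x : R | q < `|x| < a / b * q].

Let measurable_annulus q : measurable (annulus q).
Proof.
have mnorm : measurable_fun setT (fun x : R => `|x|) by exact: measurableT_comp.
have -> : annulus q = [set x : R | q < `|x|] `&` [set x | - (a / b * q) < - `|x|].
  by apply/seteqP; split => x /=; rewrite ltrN2; [move/andP|move=> h; apply/andP].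
apply: measurableI; first exact: (measurable_ray _ mnorm).
exact: (measurable_ray _ (measurable_funN mnorm)).
Qed.

(** Integrating [cones_box_disjoint]: exchange and sign symmetries give the four cones equal mass,
    and independence with equal laws makes the mass of the box a square. *)
Lemma four_cones_box (q : R) : b < a -> 0 < q ->
  4 * cone_prob + fine (P (S1 @^-1` annulus q)) ^+ 2 <= 1.
Proof.
move=> ba q0; set I := annulus q.
have mI : measurable I := measurable_annulus q.
pose f1 w := b * S2 w - a * `|S1 w|; pose f2 w := b * opp_RV S2 w - a * `|S1 w|.
pose f3 w := b * S1 w - a * `|S2 w|; pose f4 w := b * opp_RV S1 w - a * `|S2 w|.
have S21 := independent_RVs_sym S12.
have lawS' B (mB : measurable B) := esym (lawS mB).
have e2 : P [set w | 0 < f1 w] = P [set w | 0 < f2 w].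
  by apply: coneE => //; [exact: indep_opp|exact: law_opp].
have e3 : P [set w | 0 < f1 w] = P [set w | 0 < f3 w] by exact: coneE.
have e4 : P [set w | 0 < f3 w] = P [set w | 0 < f4 w].
  by apply: coneE => //; [exact: indep_opp|exact: law_opp].
have mf (X Y : {RV P >-> R}) : measurable_fun setT (fun w => b * Y w - a * `|X w|).
  by apply: measurable_funB; apply: measurable_funM => //; exact: measurableT_comp.
have mbox : measurable (S1 @^-1` I `&` S2 @^-1` I).
  by apply: measurableI; rewrite -[X in measurable X]setTI; exact: measurable_funP.
have -> : fine (P (S1 @^-1` I)) ^+ 2 = fine (P (S1 @^-1` I `&` S2 @^-1` I)).
  by rewrite S12// -lawS// fineM ?fin_num_measure// -[X in measurable X]setTI;
    exact: measurable_funP.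
have E1 : \int[P]_w (0 < f1 w)%R%:R = cone_prob by rewrite expect_ray//; exact: mf.
have E2 : \int[P]_w (0 < f2 w)%R%:R = cone_prob by rewrite expect_ray -?e2//; exact: mf.
have E3 : \int[P]_w (0 < f3 w)%R%:R = cone_prob by rewrite expect_ray -?e3//; exact: mf.
have E4 : \int[P]_w (0 < f4 w)%R%:R = cone_prob.
  by rewrite expect_ray -?e4 -?e3//; exact: mf.
have bf (X Y : {RV P >-> R}) := bmeas_ray 0 (mf X Y).
have bI := bmeas_indic R mbox.
have -> : 4 * cone_prob = cone_prob + cone_prob + cone_prob + cone_prob by ring.
rewrite -[X in X + _ + _ + _]E1 -[X in _ + X + _ + _]E2 -[X in _ + _ + X + _]E3.
rewrite -[X in _ + _ + _ + X + _]E4 -(expect_indic P mbox) -[leRHS](expect_cst P).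
rewrite -!expectD; first last.
all: try by repeat (apply: bmeasD || exact: bf || exact: bI).
apply: expect_le; first by repeat (apply: bmeasD || exact: bf || exact: bI).
  exact: bmeas_cst.
move=> w; rewrite /f1 /f2 /f3 /f4 !opp_RVE indicE.
apply: le_trans (cones_box_disjoint (S1 w) (S2 w) ba q0); rewrite lerD2l.
rewrite in_setI ler_nat.
have memI x : (x \in I) = (q < `|x| < a / b * q) by apply/idP/idP; rewrite inE.
have preI (X : T -> R) : (w \in X @^-1` I) = (X w \in I) by apply/idP/idP; rewrite !inE.
by rewrite !preI !memI leqnn.
Qed.

Lemma prob_quadrant_lt : b < a -> fine (P [set w | 0 < X1 w /\ 0 < X2 w]) < 4^-1.
Proof.
move=> ba; rewrite prob_quadrantE ltNge; apply/negP => cone_ge.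
have mS1I q : measurable (S1 @^-1` annulus q).
  by rewrite -[X in measurable X]setTI; apply: measurable_funP => //;
    exact: measurable_annulus.
have annulus0 q : 0 < q -> P (S1 @^-1` annulus q) = 0%E.
  move=> q0; have := four_cones_box ba q0 => h.
  apply/eqP; rewrite -[P _]fineK ?fin_num_measure// eqe -sqrf_eq0 eq_le sqr_ge0 andbT.
  lra.
(* The annuli with positive rational [q], enumerated by [unpickle]; countably many suffice to cover
   all nonzero reals. *)
pose F (n : nat) : set T :=
  if unpickle n is Some q then
    (if 0 < ratr q :> R then S1 @^-1` annulus (ratr q) else set0)
  else set0.
have negF n : P.-negligible (F n).
  rewrite /F; case: (unpickle n) => [q|]; last exact: negligible_set0.
  by case: ifPn => q0; [apply/negligibleP => //; exact: annulus0|exact: negligible_set0].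
have := negligible_bigcup negF => negU.
have m0 := measurable_zero (measurable_funP S1 : measurable_fun setT (S1 : T -> R)).
have cosS1 u : \int[P]_w cos (u * S1 w) = expR (- (`|u| `^ alpha)).
  by have [] := std_sym_stableP hS1 u.
have P0 : P [set w | S1 w = 0] = 0%E.
  by rewrite -[LHS]fineK ?fin_num_measure// (no_atom0 alpha_gt0 _ cosS1).
have /negligibleU /(_ negU) negT : P.-negligible [set w | S1 w = 0] by apply/negligibleP.
have : P.-negligible (setT : set T).
  apply: negligibleS negT => w _; have [Sw0|Sw0] := eqVneq (S1 w) 0; first by left.
  right; have Sw : 0 < `|S1 w| by rewrite normr_gt0.
  have r1 : 1 < a / b by rewrite ltr_pdivlMr// mul1r.
  (* A nonzero value x lies in the annulus of [q] exactly when [q] is between |x| b / a and |x|. *)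
  have lt : `|S1 w| / (a / b) < `|S1 w|.
    by rewrite ltr_pdivrMr ?(lt_trans _ r1)// ltr_pMr.
  have [q] := rat_in_itvoo lt; rewrite in_itv/= => /andP[q1 q2].
  have q0 : 0 < ratr q :> R.
    by apply: le_lt_trans q1; rewrite divr_ge0// ltW// (lt_trans _ r1).
  exists (pickle q); first by [].
  rewrite /F pickleK q0 /annulus /preimage /mkset q2 andTb.
  by move: q1; rewrite ltr_pdivrMr ?(lt_trans _ r1)// mulrC.
move=> /negligibleP -/(_ measurableT); have /= -> := @probability_setT _ _ _ P.
by move=> /eqP; rewrite onee_eq0.
Qed.

End StablePairSigns.

(** * Reduction of the three conditions to the sign of the covariance *)

Theorem proposition1p7 (R : realType) (d : measure_display)
    (T : measurableType d) (P : probability T R)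
    (alpha a : R) (S1 S2 : {RV P >-> R})
    (halpha : 0 < alpha < 2) (ha : 0 < a < 1)
    (hS1 : std_sym_stable alpha S1) (hS2 : std_sym_stable alpha S2)
    (hindep : independent_RVs S1 S2) :
  let b := (1 - a `^ alpha) `^ alpha^-1 in
  let X1 := fun w : T => a * S1 w + b * S2 w in
  let X2 := fun w : T => - a * S1 w + b * S2 w in
  let X := fun i : 'I_2 => if i == ord0 then X1 else X2 in
  (a <= 2 `^ (- alpha^-1) <-> color_process P (threshold X 0)) /\
  (color_process P (threshold X 0) <->
   forall h : R, color_process P (threshold X h)).
Proof.
move=> b X1 X2 X.
have /andP[alpha0 _] := halpha; have /andP[a0 a1] := ha; have a_ge0 := ltW a0.
have A1 : a `^ alpha < 1.
  by have := gt0_ltr_powR alpha0 _ _ a1; rewrite powR1; apply; rewrite nnegrE.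
have b0 : 0 < b by rewrite powR_gt0// subr_gt0.
have bE : b `^ alpha = 1 - a `^ alpha.
  by rewrite -powRrM mulVf ?gt_eqF// powRr1// subr_ge0 ltW.
have ab1 : a `^ alpha + b `^ alpha = 1 by rewrite bE addrC subrK.
have colorP h : color_process P (threshold X h) <->
    fine (P [set w | h < X1 w]) * fine (P [set w | h < X2 w]) <=
    fine (P [set w | h < X1 w /\ h < X2 w]).
  have mthr i : measurable [set w | threshold X h i w].
    apply: measurable_ray; rewrite /X; case: ifP => _.
      exact: measurable_X1.
    exact: measurable_X2.
  have := color_process_pairP P mthr; rewrite /threshold /X /= => ->.
  split=> [[]//|cov]; split => //.
  by rewrite (eq_ray_pair a_ge0 b0 ab1 hS1 hS2 hindep).
(* Raised to the power [alpha], condition (i) says that [a ^ alpha] is at most [1/2], that is, at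
   most [b ^ alpha]. *)
have aE : (a <= 2 `^ (- alpha^-1)) = (a `^ alpha <= 2^-1).
  have cE : (2 `^ (- alpha^-1)) `^ alpha = 2^-1 :> R.
    by rewrite -powRrM mulNr mulVf ?gt_eqF// powR_inv1.
  rewrite -cE; apply/idP/idP => [h|].
    by apply: (ge0_ler_powR (ltW alpha0)); rewrite ?nnegrE ?powR_ge0.
  apply: contraTT; rewrite -!ltNge => h.
  by apply: (gt0_ltr_powR alpha0); rewrite ?nnegrE ?powR_ge0.
have all_h : a <= 2 `^ (- alpha^-1) -> forall h, color_process P (threshold X h).
  rewrite aE => aA h; apply/colorP.
  apply: (cov_ray_ge0 alpha0 a_ge0 (ltW b0) ab1 hS1 hS2 hindep); rewrite bE; lra.
have at_0 : color_process P (threshold X 0) -> a <= 2 `^ (- alpha^-1).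
  move=> /colorP; rewrite -(eq_ray_pair a_ge0 b0 ab1 hS1 hS2 hindep).
  (* Both marginal probabilities are [1/2], so the covariance condition asks the positive quadrant
     to have mass at least [1/4]. *)
  rewrite (prob_X1_gt0 alpha0 a_ge0 b0 ab1 hS1 hS2 hindep) => cov.
  rewrite aE leNgt; apply/negP => A_gt.
  have ba : b < a.
    rewrite ltNge; apply/negP => ab.
    have := ge0_ler_powR (ltW alpha0) _ _ ab; rewrite bE !nnegrE => /(_ a_ge0 (ltW b0)).
    lra.
  have := prob_quadrant_lt alpha0 a_ge0 b0 hS1 hS2 hindep ba.
  by move: cov; rewrite /X1 /X2; lra.
split; split => //.
- by move=> h; exact: all_h.
- by move=> h; apply: all_h; exact: at_0.
Qed.
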